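(* Let $a\geq 3$ be an integer, and let $\rho$ be a root of the polynomial $x^3-ax^2-(a+3)x-1$. Then the Pythagoras number of the order $\mathbb{Z}[\rho]$ satisfies $\mathcal{P}(\mathbb{Z}[\rho])=6$.
   Context: For a commutative ring $\mathcal{O}$, put $\sum\mathcal{O}^2=\{\sum_{i=1}^n\alpha_i^2 : \alpha_i\in\mathcal{O},\ n\in\mathbb{N}\}$ (all finite sums of squares) and $\sum^m\mathcal{O}^2=\{\sum_{i=1}^m\alpha_i^2 : \alpha_i\in\mathcal{O}\}$ (sums of $m$ squares, where some $\alpha_i$ may be $0$). The Pythagoras number of $\mathcal{O}$ is $\mathcal{P}(\mathcal{O})=\min\{m\in\mathbb{N} : \sum\mathcal{O}^2=\sum^m\mathcal{O}^2\}$. *)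

(* Defs.v *)
From HB Require Import structures.
From mathcomp Require Import all_boot all_order all_algebra all_field.
From mathcomp Require Import boolp classical_sets.

Set Implicit Arguments.
Unset Strict Implicit.
Unset Printing Implicit Defensive.

Import Order.TTheory GRing.Theory Num.Theory.

Local Open Scope classical_set_scope.
Local Open Scope ring_scope.

Definition sums_of_m_squares (O : comNzRingType) (m : nat) : set O :=
  [set x | exists alpha : 'I_m -> O, x = \sum_(i < m) alpha i ^+ 2].
Arguments sums_of_m_squares : clear implicits.

Definition sums_of_squares (O : comNzRingType) : set O :=
  [set x | exists n : nat, sums_of_m_squares O n x].
Arguments sums_of_squares : clear implicits.

(* Relational, since the minimum need not exist: a ring in which no m works
   has no Pythagoras number in this sense. *)
Definition is_pythagoras_number (O : comNzRingType) (m : nat) : Prop :=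
  sums_of_squares O = sums_of_m_squares O m /\
  forall k : nat, sums_of_squares O = sums_of_m_squares O k -> (m <= k)%N.

Section ZAdjoin.
Variables (R : comNzRingType) (r : R).

Definition zadjoin : {pred R} :=
  [pred x | `[< exists p : {poly int}, x = (map_poly intr p).[r] >]].

Lemma zadjoinP (x : R) :
  reflect (exists p : {poly int}, x = (map_poly intr p).[r]) (x \in zadjoin).
Proof. exact: asboolP. Qed.

Fact zadjoin_subring_closed : subring_closed zadjoin.
Proof.
split=> [|x y|x y].
- by apply/zadjoinP; exists 1; rewrite rmorph1 hornerC.
- move=> /zadjoinP[p ->] /zadjoinP[q ->]; apply/zadjoinP.
  by exists (p - q); rewrite rmorphB hornerD hornerN.
- move=> /zadjoinP[p ->] /zadjoinP[q ->]; apply/zadjoinP.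
  by exists (p * q); rewrite rmorphM hornerM.
Qed.

HB.instance Definition _ :=
  GRing.isSubringClosed.Build R zadjoin zadjoin_subring_closed.

Record zadjoin_type : predArgType :=
  ZAdjoin { zadjoin_val : R; zadjoin_valP : zadjoin_val \in zadjoin }.

HB.instance Definition _ := [isSub for zadjoin_val].
HB.instance Definition _ := [Choice of zadjoin_type by <:].
HB.instance Definition _ := [SubChoice_isSubComNzRing of zadjoin_type by <:].

End ZAdjoin.

Notation "'Z[' r ]" := (zadjoin_type r)
  (at level 0, r at level 200, format "'Z[' r ]") : type_scope.

(* Main.v *)
(** The upper bound is a theorem of Mordell and Ko: a positive semidefinite integral ternary
    form is a sum of six squares of integral linear forms. Applied to the Gram matrix of the
    coordinates of a sum of squares in the basis of [Z[rho]], it yields six squares.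

    To prove it, one borders the Gram matrix three times so as to reach a positive definite
    unimodular matrix of size 6; by Hermite's reduction such a matrix is [M * M^T]. Passing
    to a maximal integral overlattice bounds the corank of the form modulo each prime, so
    that the first border can make the corank at most 1 everywhere, and the determinant [N]
    congruent to 1 modulo 4. The second one needs a modulus [q] of which [- N] is a square,
    in a given class modulo [N] up to squares. By quadratic reciprocity the condition on the
    primes [p] dividing [q] is [eta p = 1] for a real character [eta] modulo [4 N], and the
    classes of such [q] form a group; if it missed an admissible class, some other real
    character [f] would satisfy [f p = 1] whenever [eta p = 1]. Then the convolution
    [sum_{d k = n} f d * (f eta) k] is nonnegative, and at least 1 at the squares prime to
    [4 N], so that its sum weighted by [n^(-1/2)] diverges, whereas the hyperbola method
    bounds this sum.

    For the lower bound, let [t = - 1 / (1 + rho)]. Comparing coordinates in the basis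
    [1, rho, t] forces any decomposition of [7 + (rho - 1)^2 + (t - 1)^2] to contain the last
    two squares, up to sign, the rest being integers; and 7 is not a sum of three squares. *)

Require Import Defs.
From mathcomp Require Import all_boot all_order all_algebra all_solvable all_field.
From mathcomp Require Import ring lra zify.
From mathcomp Require Import realalg.
From mathcomp Require boolp.

Set Implicit Arguments.
Unset Strict Implicit.
Unset Printing Implicit Defensive.

Import Order.TTheory GRing.Theory Num.Theory.

(** * The Jacobi symbol by Gauss's lemma, and its reciprocity law *)

Definition absmod (m z : nat) := minn (z %% m) (m - z %% m).
Definition negmod (m z : nat) := m./2 < z %% m.

(* For [m] odd and prime to [n], [jacobi m n] is true when the Jacobi symbol (n/m) is [-1]. *)
Definition jacobi (m n : nat) : bool :=
  \big[addb/false]_(1 <= x < m./2.+1) negmod m (n * x).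

(** If two values agree, [m] divides [n * (x - y)] or [n * (x + y)], hence [x - y] or [x + y], and
    both are too small unless [x = y]. An injection of the half system into itself is a
    permutation. *)
Lemma perm_absmod m n : odd m -> coprime m n ->
  perm_eq [seq absmod m (n * x) | x <- index_iota 1 m./2.+1] (index_iota 1 m./2.+1).
Proof.
move=> om cmn; have m0 : 0 < m by case: m om {cmn}.
have hm : m = (m./2).*2.+1 by rewrite -[LHS]odd_double_half om.
set s := index_iota _ _; set h := m./2 in hm s *.
have nz x : x \in s -> 0 < (n * x) %% m.
  rewrite mem_index_iota => /andP[x1 xh].
  rewrite lt0n -[n * x %% m == 0]/(m %| n * x) Gauss_dvdr //.
  by apply/negP => /dvdn_leq; lia.
have uni : uniq [seq absmod m (n * x) | x <- s].
  rewrite map_inj_in_uniq ?iota_uniq // => x y xs ys; rewrite /absmod.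
  have := nz _ xs; have := nz _ ys; have := ltn_pmod (n * x) m0; have := ltn_pmod (n * y) m0.
  move=> lx ly nx ny emin.
  have [E|E] : (n * x) %% m = (n * y) %% m \/ (n * x) %% m + (n * y) %% m = m by lia.
    clear nx ny lx ly emin; move: xs ys E; rewrite !mem_index_iota.
    wlog xy : x y / y <= x => [W xs ys E|xs ys].
      case: (leqP y x) => [|/ltnW] xy; first exact: W.
      by apply/esym/(W y x).
    move/eqP; rewrite eqn_mod_dvd ?leq_mul2l ?xy ?orbT // -mulnBr Gauss_dvdr // => d.
    by case: (posnP (x - y)) => [|/dvdn_leq/(_ d)]; lia.
  have: m %| n * (x + y).
    by rewrite /dvdn mulnDr -modnDm E modnn.
  rewrite Gauss_dvdr // => /dvdn_leq.
  by move: xs ys; rewrite !mem_index_iota; lia.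
have sub : {subset [seq absmod m (n * x) | x <- s] <= s}.
  move=> _ /mapP[x xs ->]; have := nz _ xs; have := ltn_pmod (n * x) m0.
  by rewrite mem_index_iota /absmod; lia.
have [] := uniq_min_size uni sub; rewrite ?size_map // => _ E.
by apply: uniq_perm => //; apply: iota_uniq.
Qed.

Lemma half_index_nz m n x : odd m -> coprime m n -> x \in index_iota 1 m./2.+1 ->
  0 < (n * x) %% m.
Proof.
move=> om cmn; have hm : m = (m./2).*2.+1 by rewrite -[LHS]odd_double_half om.
rewrite mem_index_iota => /andP[x1 xh].
rewrite lt0n -[n * x %% m == 0]/(m %| n * x) Gauss_dvdr //.
by apply/negP => /dvdn_leq; lia.
Qed.

Lemma jacobi_modl m n : jacobi m (n %% m) = jacobi m n.
Proof. by apply: eq_bigr => x _; rewrite /negmod modnMml. Qed.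

(** The sign of [a * (b * x)] is that of [b * x] times that of [a * absmod m (b * x)], and the
    absolute residues of the [b * x] run through the half system again. *)
Lemma jacobiM m a b : odd m -> coprime m a -> coprime m b ->
  jacobi m (a * b) = jacobi m a (+) jacobi m b.
Proof.
move=> om ca cb; have hm : m = (m./2).*2.+1 by rewrite -[LHS]odd_double_half om.
rewrite [jacobi m a]/jacobi -(perm_big _ (perm_absmod om cb)) big_map.
rewrite -big_split /=; apply: eq_big_seq => x xs; rewrite -mulnA.
have bx0 := half_index_nz om cb xs.
have cab : coprime m (a * b) by rewrite coprimeMr ca.
have := half_index_nz om cab xs; rewrite -mulnA; move: bx0; set z := b * x => z0 az0.
rewrite /negmod /absmod; set r := z %% m.
have rm : r < m by rewrite ltn_pmod // hm.
have azr : a * z = a * r %[mod m] by rewrite modnMmr.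
have azm := @ltn_pmod (a * z) m ltac:(lia).
case: (leqP r m./2) => rh.
  by rewrite (minn_idPl _) ?addbF -?azr //; lia.
rewrite (minn_idPr _); last by lia.
have E : (a * z) %% m + (a * (m - r)) %% m = m.
  have : m %| (a * z) %% m + (a * (m - r)) %% m.
    rewrite /dvdn modnDm -modnDml azr modnDml -mulnDr subnKC 1?ltnW //.
    by rewrite modnMl.
  have := @ltn_pmod (a * (m - r)) m ltac:(lia) => l2 /dvdnP[[|[|k]] ?]; lia.
by rewrite addbT; lia.
Qed.

Lemma odd_sum I (s : seq I) F : odd (\sum_(i <- s) F i) = \big[addb/false]_(i <- s) odd (F i).
Proof. exact: (big_morph odd oddD). Qed.

(** Eisenstein's argument: modulo 2, [n x = m q + r] reads [x = q + r], and [r] differs from the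
    absolute residue by the sign bit. Summed over the half system, [x] and the absolute residues
    cancel. *)
Lemma jacobi_floor m n : odd m -> odd n -> coprime m n ->
  jacobi m n = odd (\sum_(1 <= x < m./2.+1) (n * x) %/ m).
Proof.
move=> om on cmn; have hm : m = (m./2).*2.+1 by rewrite -[LHS]odd_double_half om.
have E : \big[addb/false]_(1 <= x < m./2.+1) odd x =
   \big[addb/false]_(1 <= x < m./2.+1) odd (absmod m (n * x)).
  by rewrite -(perm_big _ (perm_absmod om cmn)) big_map.
have key : \big[addb/false]_(1 <= x < m./2.+1) odd x =
   \big[addb/false]_(1 <= x < m./2.+1) odd ((n * x) %/ m) (+)
   (\big[addb/false]_(1 <= x < m./2.+1) odd (absmod m (n * x)) (+) jacobi m n).
  rewrite -!big_split /=; apply: eq_big_seq => x xs.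
  have := divn_eq (n * x) m; have := @ltn_pmod (n * x) m ltac:(lia).
  move: (_ %/ _) => q; rewrite /absmod /negmod; move: (_ %% _) => r rm nx.
  have -> : odd x = odd (n * x) by rewrite oddM on.
  rewrite nx oddD oddM om andbT; congr (_ (+) _).
  by case: (leqP r m./2) => rh; lia.
rewrite odd_sum; move: key; rewrite -E; case: (\big[_/_]_(_ <= _ < _) odd _);
  by case: (\big[_/_]_(_ <= _ < _) odd _); case: jacobi.
Qed.

(** The lattice points of abscissa [x] below the line [m y = n x]: coprimality keeps that line free
    of points, and [x <= m./2] keeps the count within [n./2]. *)
Lemma floor_count m n x : odd m -> odd n -> coprime m n -> 0 < x <= m./2 ->
  (n * x) %/ m = \sum_(1 <= y < n./2.+1) (m * y < n * x).
Proof.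
move=> om on cmn xh; have hm : m = (m./2).*2.+1 by rewrite -[LHS]odd_double_half om.
have hn : n = (n./2).*2.+1 by rewrite -[LHS]odd_double_half on.
have m0 : 0 < m by lia.
have q1 : (n * x) %/ m <= n./2 by rewrite -ltnS ltn_divLR //; nia.
rewrite (big_cat_nat _ (n := ((n * x) %/ m).+1)) //=.
rewrite [X in _ + X]big_nat_cond [X in _ + X]big1 => [|y].
  rewrite addn0 big_nat_cond (eq_bigr (fun _ => 1)) => [|y].
    by rewrite -big_nat_cond sum_nat_const_nat muln1 subn1.
  rewrite andbT ltnS => /andP[y0]; rewrite leq_divRL // mulnC leq_eqVlt => /orP[/eqP E|->] //.
  have : m %| n * x by rewrite -E dvdn_mulr.
  by rewrite Gauss_dvdr // => /dvdn_leq; lia.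
rewrite andbT => /andP[+ _]; rewrite ltn_divLR // => h.
by apply/eqP; rewrite eqb0; lia.
Qed.

(** The two sums count the lattice points on either side of the diagonal of an [m./2] by [n./2]
    rectangle, and no point lies on it. *)
Lemma jacobi_reciprocity m n : odd m -> odd n -> coprime m n ->
  jacobi m n (+) jacobi n m = odd (m./2 * n./2).
Proof.
move=> om on cmn; have cnm : coprime n m by rewrite coprime_sym.
rewrite !jacobi_floor // -oddD; congr odd.
rewrite (eq_big_nat _ _ (F2 := fun x => \sum_(1 <= y < n./2.+1) (m * y < n * x))); last first.
  by move=> x; rewrite ltnS => xh; apply: floor_count.
rewrite [X in _ + X](eq_big_nat _ _
  (F2 := fun x => \sum_(1 <= y < m./2.+1) (n * y < m * x))); last first.
  by move=> x; rewrite ltnS => xh; apply: floor_count.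
rewrite [X in _ + X]exchange_big /= -big_split /=.
rewrite (eq_big_nat _ _ (F2 := fun=> n./2)); last first.
  move=> x; rewrite ltnS => xh; rewrite -big_split /= (eq_big_nat _ _ (F2 := fun=> 1)).
    by rewrite sum_nat_const_nat muln1 subn1.
  move=> y; rewrite ltnS => yh.
  have : m * y != n * x.
    apply/eqP => E; have : m %| n * x by rewrite -E dvdn_mulr.
    have hm : m = (m./2).*2.+1 by rewrite -[LHS]odd_double_half om.
    by rewrite Gauss_dvdr // => /dvdn_leq; lia.
  by case: ltngtP.
by rewrite sum_nat_const_nat subn1.
Qed.

Lemma jacobi_opp m : odd m -> jacobi m m.-1 = odd m./2.
Proof.
move=> om; have hm : m = (m./2).*2.+1 by rewrite -[LHS]odd_double_half om.
have {1}-> : m./2 = \sum_(1 <= x < m./2.+1) 1 by rewrite sum_nat_const_nat muln1 subn1.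
rewrite odd_sum; apply: eq_big_nat => x; rewrite ltnS => xh.
rewrite /negmod; have -> : m.-1 * x = (x.-1) * m + (m - x) by nia.
by rewrite modnMDl modn_small; lia.
Qed.

Lemma natr_Fp_eq p m n : prime p -> (m%:R == n%:R :> 'F_p)%R = (m == n %[mod p]).
Proof.
move=> pp; rewrite -(Fp_nat_mod pp m) -(Fp_nat_mod pp n).
by rewrite -val_eqE /= !val_Fp_nat // !modn_mod.
Qed.

(** The product of the [n x] over the half system is computed in two ways; the product of the half
    system itself is nonzero modulo [l] and cancels. *)
Lemma jacobi_euler l n : prime l -> odd l -> coprime l n ->
  (n%:R ^+ l./2 = (-1) ^+ jacobi l n :> 'F_l)%R.
Proof.
move=> pl ol cln; have hl : l = (l./2).*2.+1 by rewrite -[LHS]odd_double_half ol.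
set h := l./2 in hl *.
have E : (\prod_(1 <= x < h.+1) (n * x)%:R =
          \prod_(1 <= x < h.+1) ((-1) ^+ negmod l (n * x) * (absmod l (n * x))%:R) :> 'F_l)%R.
  apply: eq_bigr => x _; rewrite /negmod /absmod -/h -(Fp_nat_mod pl).
  have := @ltn_pmod (n * x) l ltac:(lia); move: (_ %% _) => r rl.
  case: (leqP r h) => rh; first by rewrite (minn_idPl _) ?expr0 ?mul1r //; lia.
  rewrite (minn_idPr _) ?expr1; last by lia.
  by rewrite (natrB _ (ltnW rl)) (pchar_Fp_0 pl) sub0r mulrNN mul1r.
move: E; rewrite big_split /= -(big_map (fun x => absmod l (n * x)) xpredT (fun k => k%:R%R)).
rewrite (perm_big _ (perm_absmod ol cln)) /= -/h.
rewrite (eq_bigr (fun x : nat => n%:R * x%:R)%R) => [|x _]; last by rewrite natrM.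
rewrite big_split /= prodr_const_nat subn1 /= => /mulIf -> //.
  by rewrite /jacobi -/h; elim/big_rec2: _ => // x b y _ ->; rewrite signr_addb.
rewrite prodf_seq_neq0; apply/allP => x; rewrite mem_index_iota => xh.
rewrite -(dvdn_pcharf (pchar_Fp pl)); apply/negP => /dvdn_leq; lia.
Qed.

(** With [h = l./2], both [n] and the [h] nonzero squares are roots of [X^h - 1]. If [n] were not a
    square, there would be [h + 1] of them. *)
Lemma jacobi_square l n : prime l -> odd l -> coprime l n -> ~~ jacobi l n ->
  exists t, t ^ 2 = n %[mod l].
Proof.
move=> pl ol cln jn; have hl : l = (l./2).*2.+1 by rewrite -[LHS]odd_double_half ol.
set h := l./2 in hl *.
have n1 := jacobi_euler pl ol cln; rewrite (negPf jn) expr0 -/h in n1.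
have [/existsP[x /eqP xn]|] := boolP [exists x : 'I_h.+1, x ^ 2 %% l == n %% l].
  by exists x.
rewrite negb_exists => /forallP nosq.
pose rs : seq 'F_l := n%:R%R :: [seq (x ^ 2)%:R%R | x <- index_iota 1 h.+1].
have : size rs < size ('X^h - 1 : {poly 'F_l})%R.
  apply: max_poly_roots.
  - by rewrite -size_poly_eq0 size_Xn_sub_1 //; have := prime_gt1 pl; lia.
  - apply/allP => z; rewrite inE => /orP[/eqP->|/mapP[x]].
      by rewrite rootE !hornerE n1 subrr.
    rewrite mem_index_iota => xh ->; rewrite rootE !hornerE subr_eq0 -natrX -expnM.
    have -> : 2 * h = totient l by rewrite totient_prime // hl /= -mul2n.
    rewrite -[1%R]/(1%:R)%R natr_Fp_eq // Euler_exp_totient // coprime_sym prime_coprime //.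
    by apply/negP => /dvdn_leq; lia.
  rewrite /= map_inj_in_uniq ?iota_uniq ?andbT.
    apply/mapP => -[x]; rewrite mem_index_iota => xh /eqP.
    rewrite natr_Fp_eq // eq_sym => xn.
    by have := nosq (@Ordinal h.+1 x ltac:(lia)); rewrite xn.
  move=> x y; rewrite !mem_index_iota => xh yh /eqP; rewrite natr_Fp_eq //.
  wlog xy : x y xh yh / y <= x => [W E|].
    case: (leqP y x) => [|/ltnW] xy; first exact: W.
    by apply/esym/(W y x) => //; rewrite eq_sym.
  rewrite eqn_mod_dvd ?leq_sqr // subn_sqr Euclid_dvdM // => /orP[] d.
    by case: (posnP (x - y)) => [|/dvdn_leq/(_ d)]; lia.
  by have := dvdn_leq _ d; lia.
by rewrite size_Xn_sub_1 /= ?size_map ?size_iota; have := prime_gt1 pl; lia.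
Qed.

Lemma coprime4n n : coprime 4 n = odd n.
Proof. by rewrite (@coprime_pexpl 2 2) // coprime2n. Qed.

(* True when the Jacobi symbol (- N / n) is [-1], provided that [N] is 1 modulo 4. *)
Definition negsq_symbol N n := jacobi N n (+) (n %% 4 == 3).

Lemma negsq_symbolM N a b : odd N -> coprime (4 * N) a -> coprime (4 * N) b ->
  negsq_symbol N (a * b) = negsq_symbol N a (+) negsq_symbol N b.
Proof.
move=> oN; rewrite !coprimeMl !coprime4n.
move=> /andP[oa ca] /andP[ob cb]; rewrite /negsq_symbol jacobiM //.
have -> : (a * b %% 4 == 3) = (a %% 4 == 3) (+) (b %% 4 == 3).
  rewrite -modnMm; have: (a %% 4) \in [:: 1; 3] by rewrite !inE; lia.
  have: (b %% 4) \in [:: 1; 3] by rewrite !inE; lia.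
  by rewrite !inE => /orP[]/eqP-> /orP[]/eqP->.
by rewrite addbACA.
Qed.

Lemma negsq_symbol_mod N n : negsq_symbol N (n %% (4 * N)) = negsq_symbol N n.
Proof.
by rewrite /negsq_symbol -jacobi_modl modn_dvdm ?dvdn_mull // jacobi_modl modn_dvdm ?dvdn_mulr.
Qed.

(** Since [N] is 1 modulo 4, the sign in the reciprocity law is trivial, and the class of [l] modulo
    4 accounts for the symbol of -1. *)
Lemma negsq_symbolP N l : N %% 4 = 1 -> prime l -> coprime (4 * N) l ->
  ~~ negsq_symbol N l -> exists t, l %| t ^ 2 + N.
Proof.
move=> N4 pl; have oN : odd N by lia.
rewrite coprimeMl coprime4n => /andP[ol cNl].
have clN : coprime l N by rewrite coprime_sym.
have cl1 : coprime l l.-1 by rewrite coprime_sym coprimePn ?prime_gt0.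
(* The number [N * l.-1] stands for [- N] modulo [l]. *)
have : jacobi l (N * l.-1) = negsq_symbol N l.
  rewrite jacobiM // jacobi_opp // /negsq_symbol.
  have := jacobi_reciprocity oN ol cNl; rewrite oddM.
  by case: (jacobi N l); case: (jacobi l N); lia.
move=> <- /(jacobi_square pl ol) []; first by rewrite coprimeMr clN.
move=> t tE; exists t; rewrite /dvdn -modnDml tE modnDml.
by rewrite -{2}[N]muln1 -mulnDr addn1 prednK ?prime_gt0 // modnMl.
Qed.

Local Open Scope ring_scope.

(** Induction on [q = m * p]: Chinese remaindering when [p] does not divide [m], a Hensel step when
    it does. *)
Lemma negsq_lift (N q : nat) : (0 < q)%N ->
  (forall p, prime p -> (p %| q)%N -> [/\ odd p, coprime p N & exists t, (p %| t ^ 2 + N)%N]) ->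
  exists t : int, (q %| t ^+ 2 + N)%Z.
Proof.
elim/ltn_ind: q => q IH q0 H.
have [q1|q1] := leqP q 1; first by exists 0; have -> : q = 1%N by [lia]; rewrite dvd1z.
have pp := pdiv_prime q1; have /dvdnP[m qE] := pdiv_dvd q.
have [op cpN [tp tpE]] := H _ pp (pdiv_dvd q).
set p := pdiv q in pp qE op cpN tpE.
have p1 := prime_gt1 pp.
have m0 : (0 < m)%N by case: m qE => [|//]; lia.
have [] := IH m; [nia|done| |].
  by move=> r pr rm; apply: H => //; rewrite qE dvdn_mulr.
move=> t /dvdzP[e tE].
have [pm|pm] := boolP (p %| m)%N; last first.
  have cmp : coprimez m p by rewrite coprimezE coprime_sym prime_coprime.
  exists (zchinese m p t tp).
  have sqmod (d x y : int) : (x = y %[mod d])%Z -> (d %| y ^+ 2 + N)%Z -> (d %| x ^+ 2 + N)%Z.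
    move=> /eqP; rewrite eqz_mod_dvd => d1 d2.
    by have -> : x ^+ 2 + N = (x - y) * (x + y) + (y ^+ 2 + N) by [ring]; rewrite rpredD ?dvdz_mulr.
  rewrite qE PoszM Gauss_dvdz //; apply/andP; split.
    by apply: sqmod (zchinese_modl cmp _ _) _; apply/dvdzP; exists e.
  apply: sqmod (zchinese_modr cmp _ _) _.
  by move: tpE; rewrite -[(_ %| _)%N]/(p %| (tp ^ 2 + N)%:Z)%Z PoszD -mulnn PoszM -expr2.
(* As [p] is odd and prime to [N], [2 t] has an inverse [u] modulo [p]. From [t^2 + N = e m], the
   correction [- e u m] of [t] makes the term in [m] divisible by [m p], and [p] divides [m] in the
   quadratic term. *)
have c2t : coprimez (2 * t) p.
  rewrite coprimezE coprime_sym prime_coprime //.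
  apply/negP => d; have : (p %| N)%N.
    have dt : (p %| t)%Z.
      move: d; rewrite abszM Euclid_dvdM // => /orP[|//].
      by move/dvdn_leq => /(_ isT); case: (p) op p1 => [|[|[|]]].
    rewrite -[(_ %| _)%N]/(p %| N%:Z)%Z.
    have -> : N%:Z = e * m - t * t by rewrite -tE; ring.
    by rewrite rpredB ?dvdz_mull.
  by move/negP: cpN; rewrite prime_coprime // => /negP/negPn.
have [[u v] /= uv] := coprimezP _ _ c2t.
exists (t + m%:Z * (- e * u)).
have /dvdnP[m' m'E] := pm.
have mZ : m%:Z = m'%:Z * p%:Z by rewrite -PoszM -m'E.
have vp : v * p%:Z = 1 - u * (2 * t) by apply: (addrI (u * (2 * t))); rewrite uv addrCA subrr addr0.
apply/dvdzP; exists (e * v + m'%:Z * e ^+ 2 * u ^+ 2); rewrite qE PoszM.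
transitivity (e * m%:Z - 2 * t * m%:Z * e * u + m%:Z * (m'%:Z * p%:Z) * e ^+ 2 * u ^+ 2).
  by rewrite -tE -mZ; ring.
rewrite [RHS](_ : _ = e * m%:Z * (v * p%:Z) +
  m%:Z * (m'%:Z * p%:Z) * e ^+ 2 * u ^+ 2); last by ring.
by rewrite vp; ring.
Qed.

(** * Primes separating two real characters *)

(** The real Dirichlet characters modulo [M], the principal one included. *)
Definition real_char (R : nzRingType) M (f : nat -> R) :=
  [/\ forall a b, f (a * b)%N = f a * f b,
      forall n, f (n %% M)%N = f n,
      forall n, coprime M n -> f n = 1 \/ f n = -1 &
      forall n, ~~ coprime M n -> f n = 0].

Lemma real_char1 (R : idomainType) M (f : nat -> R) : real_char M f -> f 1%N = 1.
Proof.
case=> fM _ f1 _; have := fM 1%N 1%N; rewrite muln1.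
case: (f1 _ (coprimen1 M)) => ->; first by [].
by rewrite mulrNN mulr1.
Qed.

(** Multiplication by [c] permutes the residues modulo [M] and changes the sign of the sum. *)
Lemma real_char_period (R : numDomainType) M (f : nat -> R) c : (0 < M)%N ->
  real_char M f -> coprime M c -> f c = -1 -> \sum_(0 <= n < M) f n = 0.
Proof.
move=> M0 [fM fmod f1 f0] cc fc.
have pe : perm_eq [seq (c * n %% M)%N | n <- index_iota 0 M] (index_iota 0 M).
  have uni : uniq [seq (c * n %% M)%N | n <- index_iota 0 M].
    rewrite map_inj_in_uniq ?iota_uniq // => x y; rewrite !mem_index_iota => xM yM /eqP.
    wlog xy : x y xM yM / (y <= x)%N => [W E|].
      case: (leqP y x) => [|/ltnW] xy; first exact: W.
      by apply/esym/(W y x) => //; rewrite eq_sym.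
    rewrite eqn_mod_dvd ?leq_mul2l ?xy ?orbT // -mulnBr Gauss_dvdr // => d.
    by case: (posnP (x - y)) => [|/dvdn_leq/(_ d)]; lia.
  have [] := uniq_min_size uni (s2 := index_iota 0 M); rewrite ?size_map //.
    by move=> _ /mapP[x xs ->]; rewrite mem_index_iota ltn_pmod.
  by move=> _ E; apply: uniq_perm => //; apply: iota_uniq.
have : \sum_(0 <= n < M) f n = - \sum_(0 <= n < M) f n.
  rewrite -[LHS](perm_big _ pe) big_map -mulN1r -fc mulr_sumr.
  by apply: eq_bigr => n _; rewrite fmod fM.
by move/eqP; rewrite -subr_eq0 opprK -mulr2n mulrn_eq0 => /eqP.
Qed.

Lemma real_char_sum_le (R : numDomainType) M (f : nat -> R) c : (0 < M)%N ->
  real_char M f -> coprime M c -> f c = -1 ->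
  forall y z, `|\sum_(y <= n < z) f n| <= (2 * M)%:R.
Proof.
move=> M0 fc cc fc1; have s0 := real_char_period M0 fc cc fc1.
have nf n : `|f n| <= 1.
  case: fc => _ _ f1 f0; have [/f1[]|/f0] := boolP (coprime M n) => ->;
  by rewrite ?normrN1 ?normr1 ?normr0 ?ler01.
have S z : `|\sum_(0 <= n < z) f n| <= M%:R.
  have step q r : \sum_(0 <= n < q * M + r) f n = \sum_(0 <= n < r) f n.
    elim: q => [//|q <-]; rewrite mulSn -addnA (big_cat_nat _ (n := M)) ?leq_addr //=.
    rewrite s0 add0r -{1}[M]add0n big_addn addKn; apply: eq_bigr => i _.
    by case: fc => _ fmod _ _; rewrite -fmod modnDr fmod.
  rewrite (divn_eq z M) step; apply: le_trans (ler_norm_sum _ _ _) _.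
  apply: (@le_trans _ _ (\sum_(0 <= n < z %% M) 1)); first exact: ler_sum.
  by rewrite big_const_nat iter_addr_0 subn0 ler_nat ltnW ?ltn_pmod.
move=> y z; have [zy|yz] := leqP z y; first by rewrite big_geq // normr0 ler0n.
have -> : \sum_(y <= n < z) f n = \sum_(0 <= n < z) f n - \sum_(0 <= n < y) f n.
  by rewrite (big_cat_nat _ (m := 0) (n := y) (p := z)) ?(ltnW yz) //= addrAC subrr add0r.
by apply: le_trans (ler_normB _ _) _; rewrite mul2n -addnn natrD lerD.
Qed.

(** Summation by parts: the differences of the decreasing weights telescope. *)
Lemma abel_le (R : numDomainType) (f u : nat -> R) (B : R) y z :
  (forall x, `|\sum_(y <= n < x) f n| <= B) ->
  (forall n, (y <= n)%N -> 0 <= u n.+1 <= u n) -> 0 <= u y ->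
  `|\sum_(y <= n < z) f n * u n| <= B * u y.
Proof.
move=> fB um uy0; have B0 : 0 <= B by apply: le_trans (fB 0%N).
have [zy|yz] := leqP z y; first by rewrite big_geq // normr0 mulr_ge0.
rewrite -(subnK yz) addnS addnC; move: (_ - _)%N => k.
pose S x := \sum_(y <= n < x) f n.
have -> : \sum_(y <= n < (y + k).+1) f n * u n =
    S (y + k).+1 * u (y + k)%N + \sum_(y <= n < (y + k)%N) S n.+1 * (u n - u n.+1).
  elim: k => [|k IH].
    by rewrite addn0 /S !big_nat1 big_geq // addr0.
  rewrite addnS big_nat_recr ?IH ?leqW ?leq_addr //=.
  rewrite [in RHS]big_nat_recr ?leq_addr //=.
  rewrite [S (y + k).+2]/S big_nat_recr ?leqW ?leq_addr //= -/(S _).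
  by ring.
have unn : (forall n, (y <= n)%N -> 0 <= u n).
  move=> n; rewrite leq_eqVlt => /orP[/eqP<- //|]; case: n => // n; rewrite ltnS => /um.
  by case/andP.
apply: (@le_trans _ _ (B * u (y + k)%N + \sum_(y <= n < y + k) B * (u n - u n.+1))).
  apply: le_trans (ler_normD _ _) _; apply: lerD.
    rewrite normrM (ger0_norm (unn _ (leq_addr _ _))); 
    by apply: ler_wpM2r; [exact/unn/leq_addr | exact: fB].
  apply: le_trans (ler_norm_sum _ _ _) _; apply: ler_sum_nat => n /andP[yn _].
  have /andP[_ d] := um _ yn.
  rewrite normrM (ger0_norm (_ : 0 <= u n - u n.+1)) ?subr_ge0 //.
  by apply: ler_wpM2r; [rewrite subr_ge0 | exact: fB].
rewrite -mulr_sumr -mulrDr ler_wpM2l // (@telescope_sumr_eq _ _ _ (fun n => - u n)) ?leq_addr //.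
  by rewrite opprK addrA subrr add0r.
by move=> n _; rewrite opprK addrC.
Qed.

(** * Dirichlet convolution of real characters *)

Definition dconv (R : pzSemiRingType) (f g : nat -> R) (n : nat) : R :=
  \sum_(d <- divisors n) f d * g (n %/ d)%N.

(** This is what splits an Euler factor off a convolution. *)
Lemma divisors_pfactor p k m : prime p -> coprime p m -> (0 < m)%N ->
  perm_eq (divisors (p ^ k * m)) [seq (p ^ i * d)%N | i <- iota 0 k.+1, d <- divisors m].
Proof.
move=> pp cpm m0; have p0 := prime_gt0 pp.
have n0 : (0 < p ^ k * m)%N by rewrite muln_gt0 expn_gt0 p0.
have cop j d : d \in divisors m -> coprime (p ^ j) d.
  by rewrite -dvdn_divisors // => dm; rewrite coprimeXl // (coprime_dvdr dm).
have logE i d : d \in divisors m -> logn p (p ^ i * d) = i.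
  move=> dm; have d0 : (0 < d)%N by move: dm; rewrite -dvdn_divisors // => /dvdn_gt0; apply.
  rewrite lognM ?expn_gt0 ?p0 // pfactorK // logn_coprime ?addn0 //.
  by have := cop 1%N d dm; rewrite expn1.
apply: uniq_perm; first exact: divisors_uniq.
  apply: allpairs_uniq; rewrite ?iota_uniq ?divisors_uniq //.
  move=> [i d] [j e] /allpairsPdep[i' [d' [_ dm [-> ->]]]]
    /allpairsPdep[j' [e' [_ em [-> ->]]]] /= E.
  have ij : i' = j' by rewrite -(logE i' d' dm) E logE.
  move: E; rewrite ij => /eqP; rewrite eqn_pmul2l ?expn_gt0 ?p0 // => /eqP -> //.
move=> d; rewrite -dvdn_divisors //; apply/idP/allpairsPdep => [dn|[i [e [ik em ->]]]].
  have d0 := dvdn_gt0 n0 dn; have [e cpe dE] := pfactor_coprime pp d0.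
  exists (logn p d), e; split; last by rewrite mulnC.
    rewrite mem_iota /= add0n ltnS.
    have := dvdn_leq_log p n0 dn; rewrite lognM ?expn_gt0 ?p0 // pfactorK //.
    by rewrite (logn_coprime cpm) addn0.
  rewrite -dvdn_divisors // -(@Gauss_dvdr _ (p ^ k)) ?coprimeXr 1?coprime_sym //.
  by apply: dvdn_trans dn; rewrite dE dvdn_mulr.
rewrite mem_iota /= ltnS in ik; rewrite -dvdn_divisors // in em.
by rewrite dvdn_mul // dvdn_exp2l.
Qed.

Section DirichletConvolution.
Variables (R : realDomainType) (M : nat) (f e : nat -> R).
Hypotheses (fchar : real_char M f) (echar : real_char M e).
Hypothesis imp : forall p, prime p -> coprime M p -> e p = 1 -> f p = 1.
Let g n := f n * e n.

Lemma real_charM : real_char M g.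
Proof.
case: fchar echar => fM fm f1 f0 [eM em e1 e0].
split => [a b|n|n /[dup] /f1 + /e1|n /f0]; rewrite /g.
- by rewrite fM eM mulrACA.
- by rewrite fm em.
- by do 2 case=> ->; rewrite ?mulr1 ?mulrN1 ?opprK; auto.
- by move=> ->; rewrite mul0r.
Qed.

Lemma real_charX h n k : real_char M h -> h (n ^ k)%N = h n ^+ k :> R.
Proof.
move=> hc; elim: k => [|k IH]; first by rewrite (real_char1 hc).
by rewrite expnS exprS -IH; case: hc.
Qed.

(** As [g = f e], each term [f(p)^i g(p)^(k-i)] is [f(p)^k e(p)^(k-i)], and the power of [f p] comes
    out of the sum. *)
Lemma dconv_pfactor p k m : prime p -> coprime p m -> (0 < m)%N ->
  dconv f g (p ^ k * m)%N =
    (f p ^+ k * \sum_(i <- iota 0 k.+1) e p ^+ (k - i)) * dconv f g m.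
Proof.
move=> pp cpm m0; have p0 := prime_gt0 pp.
rewrite /dconv (perm_big _ (divisors_pfactor k pp cpm m0)) big_allpairs_dep.
rewrite [f p ^+ k * _]mulr_sumr mulr_suml; apply: eq_big_seq => i; rewrite mem_iota /= ltnS => ik.
rewrite mulr_sumr; apply: eq_big_seq => d; rewrite -dvdn_divisors // => dm.
have d0 := dvdn_gt0 m0 dm.
have -> : (p ^ k * m %/ (p ^ i * d) = p ^ (k - i) * (m %/ d))%N.
  have dv : (p ^ i * d %| p ^ k * m)%N by rewrite dvdn_mul // dvdn_exp2l.
  apply/eqP; rewrite eq_sym eqn_div // ?muln_gt0 ?expn_gt0 ?p0 // mulnACA divnK //.
  by rewrite -expnD subnK.
case: (fchar) (real_charM) => fM _ _ _ gc; have [gM _ _ _] := gc.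
rewrite fM gM (real_charX _ _ fchar) (real_charX _ _ gc) {1}/g exprMn.
rewrite [f p ^+ k](_ : _ = f p ^+ i * f p ^+ (k - i)); last by rewrite -exprD subnKC.
by ring.
Qed.

(** Here [x = f p] and [y = e p]. If [y = 1], then [x = 1] and the value is [k + 1]; if [y = -1],
    the alternating sum is 1 for even [k] and 0 for odd [k]. *)
Lemma pfactor_term_ge (x y : R) k : (x = 1 \/ x = -1) -> (y = 1 \/ y = -1) -> (y = 1 -> x = 1) ->
  0 <= x ^+ k * \sum_(i <- iota 0 k.+1) y ^+ (k - i) /\
  (~~ odd k -> 1 <= x ^+ k * \sum_(i <- iota 0 k.+1) y ^+ (k - i)).
Proof.
move=> x1 [->|->] imp1.
  rewrite (imp1 erefl) expr1n mul1r (eq_bigr (fun=> 1)) => [|i _]; last by rewrite expr1n.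
  rewrite big_const_seq count_predT size_iota iter_addr_0 ler0n; split => // _.
  by rewrite ler1n.
have -> : \sum_(i <- iota 0 k.+1) (-1) ^+ (k - i) = (~~ odd k)%:R :> R.
  have -> : iota 0 k.+1 = index_iota 0 k.+1 by [].
  elim: k => [|k IH]; first by rewrite big_nat1.
  rewrite big_nat_recl //= IH subn0 -signr_odd /=.
  by case: (odd k); rewrite /= ?expr0 ?expr1 ?addr0 ?addNr.
case ok: (odd k); first by rewrite mulr0.
have -> : x ^+ k = 1.
  by case: x1 => ->; rewrite ?expr1n // -signr_odd ok.
by rewrite mulr1 ler01.
Qed.

(** The powers of primes are peeled off one at a time. Each factor is bounded by [pfactor_term_ge],
    or vanishes when the prime divides [M]. *)
Lemma dconv_ge n : (0 < n)%N ->
  0 <= dconv f g n /\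
  (coprime M n -> (forall p, ~~ odd (logn p n)) -> 1 <= dconv f g n).
Proof.
elim/ltn_ind: n => n IH n0.
have [n1|n1] := leqP n 1.
  have -> : n = 1%N by lia.
  rewrite /dconv big_seq1 (real_char1 fchar) (real_char1 real_charM) mulr1.
  by rewrite ler01.
have pp := pdiv_prime n1; set p := pdiv n in pp.
have [m cpm nE] := pfactor_coprime pp n0.
set k := logn p n in nE.
have k0 : (0 < k)%N by rewrite logn_gt0 mem_primes pp n0 pdiv_dvd.
have m0 : (0 < m)%N by move: n0; rewrite nE; case: (m).
have mn : (m < n)%N.
  rewrite nE -{1}[m]muln1 ltn_pmul2l // -(expn0 p) ltn_exp2l // prime_gt1 //.
have [IH1 IH2] := IH _ mn m0.
rewrite nE mulnC dconv_pfactor //.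
have [cMp|cMp] := boolP (coprime M p); last first.
  have [_ _ _ f0] := fchar; rewrite f0 // expr0n gtn_eqF // !mul0r lexx.
  by split=> //; rewrite coprimeMr coprime_pexpr // (negPf cMp).
have [_ _ f1 _] := fchar; have [_ _ e1 _] := echar.
have [T1 T2] := pfactor_term_ge k (f1 _ cMp) (e1 _ cMp) (imp pp cMp).
split; first exact: mulr_ge0.
rewrite coprimeMr => /andP[_ cMm] even.
have ek : ~~ odd k.
  by have := even p; rewrite mulnC -nE.
rewrite -[1]mulr1; apply: ler_pM => //; first exact: T2.
apply: IH2 => // r; have := even r.
have [-> _|rp] := eqVneq r p; first by rewrite (logn_coprime cpm).
rewrite lognM ?expn_gt0 ?(prime_gt0 pp) //.
have [pr|npr] := boolP (prime r); last by rewrite /logn (negPf npr).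
by rewrite lognX (logn_prime r pp) (negPf rp) muln0 add0n.
Qed.

End DirichletConvolution.

(** * The hyperbola method *)

Lemma sum_mul_le (R : pzRingType) (F G : nat -> R) Y d : (0 < d)%N ->
  \sum_(1 <= k < Y.+1 | (d * k <= Y)%N) F d * G k =
  F d * \sum_(1 <= k < (Y %/ d).+1) G k.
Proof.
move=> d0; rewrite mulr_sumr (@big_nat_widen _ _ _ _ (Y %/ d).+1 Y.+1) ?ltnS ?leq_div //.
by apply: eq_bigl => k; rewrite ltnS leq_divRL // mulnC.
Qed.

(** The pairs under the hyperbola are split according to [d <= X]; when [d > X], [k] is at most [X]
    and becomes the outer variable. *)
Lemma hyperbola (R : pzRingType) (F G : nat -> R) X : (forall d k, F d * G k = G k * F d) ->
  \sum_(1 <= d < (X ^ 2).+1) \sum_(1 <= k < (X ^ 2).+1 | (d * k <= X ^ 2)%N) F d * G k =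
  \sum_(1 <= d < X.+1) F d * \sum_(1 <= k < (X ^ 2 %/ d).+1) G k +
  \sum_(1 <= k < X.+1) G k * \sum_(X.+1 <= d < (X ^ 2 %/ k).+1) F d.
Proof.
move=> comm; have XY : (X <= X ^ 2)%N by rewrite -{1}[X]expn1; case: X => // X; rewrite leq_pexp2l.
set Y := (X ^ 2)%N in XY *.
rewrite (@big_cat_nat _ _ _ X.+1 1 Y.+1) //=; congr (_ + _).
  by apply: eq_big_nat => d /andP[d0 _]; rewrite sum_mul_le.
under eq_bigr do rewrite big_mkcond.
rewrite exchange_big /= (@big_cat_nat _ _ _ X.+1 1 Y.+1) //= [X in _ + X]big_nat_cond.
rewrite [X in _ + X]big1 ?addr0 => [|k /andP[/andP[kX _] _]]; last first.
  rewrite -big_mkcond big_nat_cond big1 // => d /andP[/andP[dX _]].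
  by rewrite /Y -mulnn; nia.
apply: eq_big_nat => k /andP[k0 _]; rewrite -big_mkcond mulr_sumr /=.
rewrite (@big_nat_widen _ _ _ _ (Y %/ k).+1 Y.+1) ?ltnS ?leq_div //.
by apply: eq_big => [d|d _]; rewrite ?comm // ltnS leq_divRL.
Qed.

Lemma sum_dconv (R : comNzRingType) (F G : nat -> R) Y :
  \sum_(1 <= n < Y.+1) dconv F G n =
  \sum_(1 <= d < Y.+1) \sum_(1 <= k < Y.+1 | (d * k <= Y)%N) F d * G k.
Proof.
transitivity (\sum_(1 <= n < Y.+1) \sum_(1 <= d < Y.+1)
  \sum_(1 <= k < Y.+1 | (d * k == n)%N) F d * G k).
  apply: eq_big_nat => n /andP[n0 nY].
  have pe : perm_eq (divisors n) [seq d <- index_iota 1 Y.+1 | (d %| n)%N].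
    apply: uniq_perm; rewrite ?divisors_uniq ?filter_uniq ?iota_uniq // => d.
    rewrite -dvdn_divisors // mem_filter mem_index_iota; case: (boolP (d %| n)%N) => //= dn.
    by rewrite (dvdn_gt0 n0 dn) ltnS (leq_trans (dvdn_leq n0 dn)).
  rewrite /dconv (perm_big _ pe) big_filter /= big_mkcond.
  apply: eq_big_nat => d /andP[d0 _]; case: ifP => dn.
    rewrite (eq_bigl (fun k => k == (n %/ d)%N)) => [|k].
      by rewrite big_nat1_eq divn_gt0 // dvdn_leq //= ltnS (leq_trans (leq_div _ _)).
    by rewrite eqn_div // mulnC.
  rewrite big1 // => k /eqP E.
  by rewrite -E dvdn_mulr in dn.
rewrite exchange_big /=; apply: eq_big_nat => d /andP[d0 _].
under eq_bigr do rewrite big_mkcond.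
rewrite exchange_big /= [RHS]big_mkcond; apply: eq_big_nat => k /andP[k0 _].
rewrite -big_mkcond (eq_bigl (fun n => n == (d * k)%N)) => [|n]; last by rewrite eq_sym.
by rewrite big_nat1_eq muln_gt0 d0 k0 /= ltnS.
Qed.

(** * Sums of inverse square roots and harmonic sums *)

Section InverseSqrt.
Variable R : rcfType.
Definition isqrt (n : nat) : R := (Num.sqrt n%:R)^-1.

Lemma isqrt_ge0 n : 0 <= isqrt n. Proof. by rewrite invr_ge0 sqrtr_ge0. Qed.

Lemma isqrtM a b : isqrt (a * b) = isqrt a * isqrt b.
Proof. by rewrite /isqrt natrM sqrtrM ?ler0n // invfM. Qed.

Lemma isqrt_le m n : (0 < m)%N -> (m <= n)%N -> isqrt n <= isqrt m.
Proof.
move=> m0 mn; rewrite lef_pV2 ?posrE ?sqrtr_gt0 ?ltr0n ?(leq_trans m0 mn) //.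
by rewrite ler_sqrt ?ler0n // ler_nat.
Qed.

(** Telescoping of [1 / sqrt (X + 1) <= 2 (sqrt (X + 1) - sqrt X)]. *)
Lemma sum_isqrt X : \sum_(1 <= d < X.+1) isqrt d <= 2 * Num.sqrt X%:R.
Proof.
elim: X => [|X IH]; first by rewrite big_geq // mulr_ge0 // sqrtr_ge0.
rewrite big_nat_recr //=; apply: le_trans (lerD IH (lexx _)) _.
have s0 : 0 < Num.sqrt X.+1%:R :> R by rewrite sqrtr_gt0 ltr0n.
have t0 : 0 <= Num.sqrt X%:R :> R by rewrite sqrtr_ge0.
have ts : Num.sqrt X%:R <= Num.sqrt X.+1%:R :> R by rewrite ler_sqrt ?ler0n // ler_nat.
have sE : Num.sqrt X.+1%:R ^+ 2 = Num.sqrt X%:R ^+ 2 + 1 :> R.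
  by rewrite !sqr_sqrtr ?ler0n // -natr1.
rewrite -lerBrDl -mulrBr /isqrt -[_^-1]mul1r ler_pdivrMr //.
move: s0 t0 ts sE; set s := Num.sqrt _; set t := Num.sqrt _ => *; nra.
Qed.

Lemma sum_isqrtM X : (\sum_(1 <= d < X.+1) isqrt d) * isqrt X.+1 <= 2.
Proof.
apply: (@le_trans _ _ (2 * Num.sqrt X%:R * isqrt X.+1)).
  by rewrite ler_wpM2r ?isqrt_ge0 ?sum_isqrt.
have s0 : 0 < Num.sqrt X.+1%:R :> R by rewrite sqrtr_gt0 ltr0n.
by rewrite ler_pdivrMr // ler_pM2l // ler_sqrt ?ler0n // ler_nat.
Qed.

(** Each dyadic block contributes at least one half. *)
Lemma harmonic_ge k : k%:R / 2 <= \sum_(1 <= j < (2 ^ k).+1) j%:R^-1 :> R.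
Proof.
elim: k => [|k IH]; first by rewrite mul0r big_nat1 invr1 ler01.
rewrite (@big_cat_nat _ _ _ (2 ^ k).+1) //=; last by rewrite ltnS leq_exp2l.
rewrite -natr1 mulrDl; apply: lerD => //.
apply: (@le_trans _ _ (\sum_((2 ^ k).+1 <= j < (2 ^ k.+1).+1) (2 ^ k.+1)%:R^-1)).
  have p0 : (2 ^ k)%:R != 0 :> R by rewrite pnatr_eq0 -lt0n expn_gt0.
  rewrite sumr_const_nat subSS expnS mul2n -addnn addnK -mulr_natl natrD.
  by rewrite le_eqVlt; apply/orP; left; apply/eqP; field;
    rewrite -natrD pnatr_eq0 addnn double_eq0 -lt0n expn_gt0.
apply: ler_sum_nat => j /andP[j1 j2]; rewrite lef_pV2 ?posrE ?ltr0n ?expn_gt0 ?ler_nat //.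
by apply: leq_trans j1.
Qed.

End InverseSqrt.

Lemma sum_subset_le (R : numDomainType) (F : nat -> R) (s t : seq nat) :
  uniq s -> uniq t -> {subset s <= t} -> (forall n, n \in t -> 0 <= F n) ->
  \sum_(n <- s) F n <= \sum_(n <- t) F n.
Proof.
move=> us ut st F0; rewrite [leRHS](bigID (mem s)) /= -[X in _ <= X + _]big_filter.
have pe : perm_eq [seq n <- t | n \in s] s.
  apply: uniq_perm; rewrite ?filter_uniq // => n; rewrite mem_filter.
  by case: (boolP (n \in s)) => //= /st.
rewrite (perm_big _ pe) /= lerDl big_seq_cond sumr_ge0 // => n /andP[nt _].
exact: F0.
Qed.

(** * Divergence at the squares against the hyperbola bound *)

Section Nonvanishing.
Variables (R : rcfType) (M : nat) (f e : nat -> R).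
Hypotheses (M0 : (0 < M)%N) (fchar : real_char M f) (echar : real_char M e).
Let g n := f n * e n.
Let u := @isqrt R.

Lemma char_isqrt_le h c y z : real_char M h -> coprime M c -> h c = -1 -> (0 < y)%N ->
  `|\sum_(y <= n < z) h n * u n| <= (2 * M)%:R * u y.
Proof.
move=> hc cc hc1 y0; apply: abel_le => [x|n yn|]; last exact: isqrt_ge0.
  exact: real_char_sum_le M0 hc cc hc1 y x.
by rewrite isqrt_ge0 isqrt_le // (leq_trans y0 yn).
Qed.

Lemma norm_char_isqrt h n : real_char M h -> `|h n * u n| <= u n.
Proof.
case=> _ _ h1 h0; rewrite normrM (ger0_norm (isqrt_ge0 R n)) ler_piMl ?isqrt_ge0 //.
by have [/h1[]|/h0] := boolP (coprime M n) => ->; rewrite ?normrN1 ?normr1 ?normr0 ?ler01.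
Qed.

(** Bounds the error terms of the hyperbola method uniformly in [X]: the sum of the [d^(-1/2)] grows
    like [X^(1/2)], which the decay of the tails [r d] compensates. *)
Lemma norm_sum_char h (r : nat -> R) (C : R) X : real_char M h ->
  (forall d, (0 < d <= X)%N -> `|r d| <= C * u X.+1) -> 0 <= C ->
  `|\sum_(1 <= d < X.+1) h d * u d * r d| <= C * 2.
Proof.
move=> hc rC C0; apply: le_trans (ler_norm_sum _ _ _) _.
apply: (@le_trans _ _ (\sum_(1 <= d < X.+1) C * (u d * u X.+1))).
  apply: ler_sum_nat => d dX; rewrite normrM mulrCA.
  by apply: ler_pM => //; [exact: norm_char_isqrt | exact: rC].
by rewrite -mulr_sumr -mulr_suml ler_wpM2l // sum_isqrtM.
Qed.

(** Without such a prime, [dconv_ge] applies to [f] and [g = f e]. The weighted sum [T] of their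
    convolution is then at least a multiple of a harmonic sum, while [c1] and [c2] make both
    characters nonprincipal, so that [T] is bounded independently of [X]. *)
Lemma exists_split_prime c1 c2 : coprime M c1 -> f c1 = -1 -> coprime M c2 -> g c2 = -1 ->
  exists p, [/\ prime p, coprime M p, e p = 1 & f p = -1].
Proof.
move=> cc1 fc1 cc2 gc2; have gchar : real_char M g := real_charM fchar echar.
apply: boolp.contrapT => nop.
have imp p : prime p -> coprime M p -> e p = 1 -> f p = 1.
  move=> pp cp ep; have [_ _ f1 _] := fchar; case: (f1 p cp) => // fp.
  by case: nop; exists p.
pose B : R := (2 * M)%:R; have B0 : 0 <= B by rewrite ler0n.
(* At this exponent, [harmonic_ge] divided by [M.+1] gives [4 M^2 + 8 M + 1], one more than the
   upper bound [B^2 + 4 B]. The choice of [X] ensures [1 + M j <= X] for [0 < j <= J]. *)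
pose J := (2 ^ (2 * (M.+1 * (4 * M ^ 2 + 8 * M).+1)))%N.
pose X := (M.+1 * J)%N; pose Y := (X ^ 2)%N.
pose F n := f n * u n; pose G n := g n * u n.
pose T := \sum_(1 <= n < Y.+1) dconv F G n.
have u1 : u 1 = 1 by rewrite /u /isqrt sqrtr1 invr1.
have dconvE n : (0 < n)%N -> dconv F G n = dconv f g n * u n.
  move=> n0; rewrite /dconv mulr_suml; apply: eq_big_seq => d; rewrite -dvdn_divisors // => dn.
  by rewrite /F /G mulrACA -isqrtM mulnC divnK.
have upper : `|T| <= B ^+ 2 + 4 * B.
  rewrite /T sum_dconv (@hyperbola R F G X) => [|d k]; last exact: mulrC.
  (* Cutting the inner sum at [X] leaves a product of two bounded sums and an error term similar to
     the other one. *)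
  have -> : \sum_(1 <= d < X.+1) F d * \sum_(1 <= k < (X ^ 2 %/ d).+1) G k =
    (\sum_(1 <= d < X.+1) F d) * (\sum_(1 <= k < X.+1) G k) +
    \sum_(1 <= d < X.+1) F d * \sum_(X.+1 <= k < (X ^ 2 %/ d).+1) G k.
    rewrite mulr_suml -big_split; apply: eq_big_nat => d /andP[d0 dX] /=.
    rewrite -mulrDr -big_cat_nat // ltnS leq_divRL //.
    by rewrite -mulnn leq_mul2l -ltnS dX orbT.
  have S1 : `|\sum_(1 <= d < X.+1) F d| <= B.
    by have := char_isqrt_le X.+1 fchar cc1 fc1 (ltn0Sn 0); rewrite u1 mulr1.
  have S2 : `|\sum_(1 <= d < X.+1) G d| <= B.
    by have := char_isqrt_le X.+1 gchar cc2 gc2 (ltn0Sn 0); rewrite u1 mulr1.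
  have S3 : `|\sum_(1 <= d < X.+1) F d * \sum_(X.+1 <= k < (X ^ 2 %/ d).+1) G k| <= B * 2.
    by apply: norm_sum_char => // d _; apply: char_isqrt_le gchar cc2 gc2 _.
  have S4 : `|\sum_(1 <= d < X.+1) G d * \sum_(X.+1 <= k < (X ^ 2 %/ d).+1) F k| <= B * 2.
    by apply: norm_sum_char => // d _; apply: char_isqrt_le fchar cc1 fc1 _.
  have S12 := ler_pM (normr_ge0 _) (normr_ge0 _) S1 S2.
  apply: le_trans (ler_normD _ _) _; apply: le_trans (lerD (ler_normD _ _) S4) _.
  apply: le_trans (lerD (lerD _ S3) (lexx _)) _; first by rewrite normrM; exact: S12.
  by rewrite -expr2; lra.
have lower : (4 * M ^ 2 + 8 * M).+1%:R <= T.
  (* At these squares, prime to [M], the coefficient is at least 1 and the weight [1 / (1 + M j)] is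
     at least [1 / ((M + 1) j)]. *)
  pose s := [seq ((1 + M * j) ^ 2)%N | j <- index_iota 1 J.+1].
  apply: (@le_trans _ _ (\sum_(n <- s) dconv F G n)); last first.
    apply: sum_subset_le; rewrite ?iota_uniq //.
    - rewrite map_inj_uniq ?iota_uniq // => i j /eqP; rewrite eqn_exp2r // => /eqP; nia.
    - move=> _ /mapP[j + ->]; rewrite !mem_index_iota expn_gt0 /= !ltnS => /andP[j0 jJ].
      by rewrite /Y leq_exp2r // /X; nia.
    move=> n; rewrite mem_index_iota => /andP[n0 _]; rewrite dconvE // mulr_ge0 ?isqrt_ge0 //.
    by have [] := dconv_ge fchar echar imp n0.
  rewrite big_map; apply: (@le_trans _ _ (\sum_(1 <= j < J.+1) M.+1%:R^-1 * j%:R^-1)).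
    rewrite -mulr_sumr mulrC ler_pdivlMr ?ltr0n // -natrM.
    have half2 a b : (a * b)%:R = (2 * (b * a))%:R / 2 :> R by rewrite !natrM; field.
    by rewrite half2; exact: harmonic_ge.
  apply: ler_sum_nat => j /andP[j0 _].
  have p0 : (0 < (1 + M * j) ^ 2)%N by rewrite expn_gt0.
  have [_ ge1] := dconv_ge fchar echar imp p0.
  rewrite dconvE //; apply: (@le_trans _ _ (u ((1 + M * j) ^ 2))).
    rewrite /u /isqrt natrX sqrtr_sqr ger0_norm ?ler0n // -invfM -natrM.
    by rewrite lef_pV2 ?posrE ?ltr0n // ?ler_nat; nia.
  rewrite ler_peMl ?isqrt_ge0 // ge1 //.
    by rewrite coprimeXr // /coprime addnC mulnC gcdnMDl gcdn1.
  by move=> p; rewrite lognX mul2n odd_double.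
have BE : B ^+ 2 + 4 * B = (4 * M ^ 2 + 8 * M)%:R.
  by rewrite /B -natrX -natrM -natrD; congr (_%:R); nia.
have := le_trans lower (le_trans (ler_norm T) upper).
by rewrite BE ler_nat ltnn.
Qed.

End Nonvanishing.

(** * Moduli of which [- N] is a square in a prescribed class *)

Section SeparatingCharacter.
Local Open Scope nat_scope.
Variables (M : nat) (M0 : (0 < M)%N).

Definition residue n : 'I_M := Ordinal (ltn_pmod n M0).

Lemma residue_eq m n : (residue m == residue n) = (m == n %[mod M]).
Proof. by []. Qed.

Lemma residueE m n : m = n %[mod M] -> residue m = residue n.
Proof. by move=> E; apply/eqP; rewrite residue_eq E. Qed.

Lemma residue_ord (x : 'I_M) : residue x = x.
Proof. by apply: val_inj; rewrite /= modn_small. Qed.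

(** Closure under inverses follows from the last clause, the inverse of [w] being [w] times the
    square of that inverse. *)
Definition square_submonoid (S : {set 'I_M}) :=
  [/\ forall n, residue n \in S -> coprime M n,
      forall m n, residue m \in S -> residue n \in S -> residue (m * n) \in S &
      forall n, coprime M n -> residue (n ^ 2) \in S].

Lemma inv_mod n : coprime M n -> exists2 k, coprime M k & n * k = 1 %[mod M].
Proof.
move=> cn; have [n0|n0] := posnP n.
  exists 1%N; rewrite ?coprimen1 //; move: cn.
  by rewrite n0 /coprime gcdn0 => /eqP ->; rewrite !modn1.
case: (egcdnP M n0) => k l E _; exists k.
  have : coprime M (k * n) by rewrite E gcdnC (eqP cn) /coprime gcdnMDl gcdn1.
  by rewrite coprimeMr => /andP[].
by rewrite mulnC E modnMDl gcdnC (eqP cn).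
Qed.

Lemma square_submonoid_cancel S z w : square_submonoid S -> coprime M z ->
  residue w \in S -> residue (z * w) \in S -> residue z \in S.
Proof.
move=> [Sc SM S2] cz wS zwS; have [k ck wk] := inv_mod (Sc _ wS).
have <- : residue ((z * w) * w * (k ^ 2)) = residue z; last exact: SM (SM _ _ zwS wS) (S2 _ ck).
apply: residueE.
have -> : (z * w * w * k ^ 2 = z * ((w * k) * (w * k)))%N by rewrite -mulnn; ring.
by rewrite -modnMmr -(modnMm (w * k)) !wk modnMm modnMmr !muln1.
Qed.

(* The last clause says that [S] has index 2 in the group of units: a square submonoid of
   units is a group, and its maximality puts [r] in the one generated by [S] and [n]. *)
Lemma max_square_submonoid (W : {set 'I_M}) r : square_submonoid W -> residue r \notin W ->
  coprime M r ->
  exists S : {set 'I_M}, [/\ W \subset S, square_submonoid S, residue r \notin S &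
    forall n, coprime M n -> residue n \notin S -> exists2 x, residue x \in S & r = n * x %[mod M]].
Proof.
move=> WP rW cr.
pose P (S : {set 'I_M}) := boolp.asbool (square_submonoid S) && (residue r \notin S).
have PW : P W by rewrite /P rW andbT; apply/boolp.asboolP.
have [S /maxsetP[/andP[/boolp.asboolP SP rS] Smax] WS] := maxset_exists PW.
exists S; split => // n cn nS; have [Sc SM S2] := SP.
(* Two cosets suffice, since [n ^ 2] already lies in [S]. *)
pose S' := S :|: [set residue (n * x) | x : 'I_M in S].
have inS' z : reflect
    (residue z \in S \/ exists2 x, residue x \in S & z = n * x %[mod M]) (residue z \in S').
  apply: (iffP setUP) => -[zS|]; [by left| |by left|].
    move=> /imsetP[x xS /eqP]; rewrite residue_eq => /eqP E.
    by right; exists x; rewrite ?residue_ord.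
  move=> [x xS E]; right; apply/imsetP; exists (residue x) => //.
  by apply/residueE; rewrite E /= modnMmr.
have [rS'|rS'] := boolP (residue r \in S').
  by case/inS': rS' => // rS'; rewrite rS' in rS.
have S'P : square_submonoid S'.
  split=> [z /inS'[/Sc //|[x /Sc cx E]]|z w /inS' zS /inS' wS|z cz].
  - by rewrite -coprime_modr E coprime_modr coprimeMr cn.
  - apply/inS'; case: zS wS => [zS|[x xS xE]] [wS|[y yS yE]].
    + by left; apply: SM.
    + right; exists (z * y)%N; first exact: SM.
      by rewrite -modnMmr yE modnMmr; congr (_ %% _)%N; ring.
    + right; exists (x * w)%N; first exact: SM.
      by rewrite -modnMml xE modnMml mulnA.
    + left; have <- : residue (n ^ 2 * (x * y)) = residue (z * w).
        2: exact: SM (S2 _ cn) (SM _ _ xS yS).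
      apply: residueE; rewrite -[in RHS]modnMm xE yE modnMm -mulnn; congr (_ %% _)%N; ring.
  - by apply/inS'; left; apply: S2.
have PS' : P S' by rewrite /P rS' andbT; apply/boolp.asboolP.
have S'S := Smax _ PS' (subsetUl _ _).
case/negP: nS; rewrite -S'S; apply/inS'; right; exists 1%N; last by rewrite muln1.
by have := S2 1%N (coprimen1 _).
Qed.

(** A maximal [S] containing [W] but not [r] has index 2, so that the sign of membership in [S] is a
    character. *)
Lemma separating_char (R : nzRingType) (W : {set 'I_M}) r : square_submonoid W ->
  residue r \notin W -> coprime M r ->
  exists f : nat -> R, [/\ real_char M f, f r = (-1)%R & forall n, residue n \in W -> f n = 1%R].
Proof.
move=> WP rW cr; have [S [WS SP rS nSP]] := max_square_submonoid WP rW cr.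
have [Sc SM S2] := SP.
exists (fun n => if coprime M n then (-1) ^+ (residue n \notin S) else 0)%R; split.
- split=> [a b|n|n ->|n /negPf ->] //; last first.
  + by case: (_ \notin _); [right|left].
  + by rewrite coprime_modr (residueE (modn_mod n M)).
  rewrite coprimeMr; case ca: (coprime M a); last by rewrite mul0r.
  case cb: (coprime M b); last by rewrite mulr0.
  rewrite /= -signr_addb; congr (_ ^+ nat_of_bool _)%R.
  have cab : coprime M (a * b) by rewrite coprimeMr ca.
  have [aS|aS] := boolP (residue a \in S); have [bS|bS] := boolP (residue b \in S).
  + by rewrite SM.
  + apply: contra bS => abS; apply: square_submonoid_cancel SP cb aS _.
    by rewrite mulnC.
  + by apply: contra aS => abS; apply: square_submonoid_cancel SP ca bS abS.
  (* Two units outside [S]: [r = a x = b y] gives [(a b) (x y) = r^2], which is in [S]. *)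
  + have [x xS xE] := nSP _ ca aS; have [y yS yE] := nSP _ cb bS.
    apply/negbTE/negPn; apply: square_submonoid_cancel SP cab (SM _ _ xS yS) _.
    have <- : residue (r ^ 2) = residue (a * b * (x * y)); last exact: S2.
    by apply: residueE; rewrite -mulnn -modnMm {1}xE yE modnMm; congr (_ %% _)%N; ring.
- by rewrite cr rS.
- by move=> n nW; have nS := subsetP WS _ nW; rewrite (Sc _ nS) nS.
Qed.

End SeparatingCharacter.

Lemma negsq_real_char (R : nzRingType) N : odd N ->
  real_char (4 * N) (fun n => if coprime (4 * N) n then (-1) ^+ negsq_symbol N n else 0 : R).
Proof.
move=> oN; split=> [a b|n|n ->|n /negPf ->] //; last first.
- by case: negsq_symbol; [right|left].
- by rewrite coprime_modr negsq_symbol_mod.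
rewrite coprimeMr; case ca: (coprime _ a); last by rewrite mul0r.
case cb: (coprime _ b); last by rewrite mulr0.
by rewrite /= -signr_addb negsq_symbolM.
Qed.

(** Let [W] be the classes modulo [4 N] reached, up to a square, by products of primes with trivial
    symbol. If [W] missed the lift [r'] of [r], some character [f] would be 1 on [W] and -1 at [r'].
    Then a prime with trivial symbol would satisfy [f p = -1], although its own class is in [W]. *)
Lemma residue_class_split_prime N r : (N %% 4 = 1)%N -> coprime N r ->
  exists q s, [/\ (0 < q)%N, q = (r * s ^ 2)%N %[mod N] &
    forall p, prime p -> (p %| q)%N -> coprime (4 * N) p && ~~ negsq_symbol N p].
Proof.
move=> N4 cNr; have oN : odd N by lia.
have N0 : (0 < N)%N by lia.
have c4N : coprime 4 N by rewrite coprime4n.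
pose M := (4 * N)%N; have M0 : (0 < M)%N by rewrite /M; lia.
(* The class modulo 4 that makes the symbol of the lift trivial. *)
pose x := if jacobi N r then 3%N else 1%N.
pose r' := chinese 4 N x r.
have r'4 : (r' %% 4 = x)%N by rewrite (chinese_modl c4N) /x; case: jacobi.
have r'N : r' = r %[mod N] := chinese_modr c4N _ _.
have cr' : coprime M r'.
  rewrite coprimeMl coprime4n -(coprime_modr N) r'N coprime_modr cNr andbT.
  by move: r'4; rewrite /x; case: jacobi; lia.
have er' : ~~ negsq_symbol N r'.
  rewrite /negsq_symbol -jacobi_modl r'N jacobi_modl r'4 /x.
  by case: jacobi.
pose good q := forall p, prime p -> (p %| q)%N -> coprime M p && ~~ negsq_symbol N p.
pose inW (z : nat) := coprime M z /\
  exists q s, [/\ (0 < q)%N, good q, coprime M s & q = (z * s ^ 2)%N %[mod M]].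
pose W := [set z : 'I_M | boolp.asbool (inW z)].
have WE z : reflect (inW z) (residue M0 z \in W).
  rewrite inE; apply: (iffP (boolp.asboolP _)) => -[cz [q [s [q0 gq cs E]]]]; split.
  - by rewrite /= coprime_modr in cz.
  - by exists q, s; split => //; rewrite E /= modnMml.
  - by rewrite /= coprime_modr.
  - by exists q, s; split => //; rewrite E /= modnMml.
have [/WE[_ [q [s [q0 gq _ E]]]]|r'W] := boolP (residue M0 r' \in W).
  exists q, s; split => //; apply/eqP; have /eqP := E; rewrite /M.
  move=> /eqP/(congr1 (modn^~ N)); rewrite !modn_dvdm ?dvdn_mull // => ->.
  by rewrite -modnMml r'N modnMml.
have WP : square_submonoid M0 W.
  split=> [z /WE[]//|z w /WE[cz [q [s [q0 gq cs E]]]] /WE[cw [q' [s' [q'0 gq' cs' E']]]]|z cz].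
    apply/WE; split; first by rewrite coprimeMr cz.
    exists (q * q')%N, (s * s')%N; split; first by rewrite muln_gt0 q0.
    - by move=> p pp; rewrite Euclid_dvdM // => /orP[/gq|/gq']; apply.
    - by rewrite coprimeMr cs.
    - by rewrite -modnMm E E' modnMm expnMn; congr (_ %% _)%N; ring.
  apply/WE; split; first by rewrite coprimeXr.
  have [k ck zk] := inv_mod cz.
  exists 1%N, k; split => //; first by move=> p pp; rewrite dvdn1 => /eqP p1; rewrite p1 in pp.
  by rewrite -expnMn -modnXm zk modnXm exp1n.
have [f [fc fr fW]] := separating_char realalg WP r'W cr'.
have ec := negsq_real_char realalg oN.
have [p [pp cp ep fp]] : exists p, [/\ prime p, coprime M p,
    (if coprime M p then (-1) ^+ negsq_symbol N p else 0 : realalg) = 1 & f p = -1].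
  (* The same [r'] serves twice: [f] is -1 there, and so is its product with the symbol, which is
     trivial at [r']. *)
  apply: (exists_split_prime M0 fc ec cr' fr cr').
  by rewrite fr cr' (negPf er') mulr1.
rewrite cp in ep.
have sp : ~~ negsq_symbol N p.
  apply/negP => sp; move: ep; rewrite sp expr1 => /eqP.
  by rewrite lt_eqF // (@lt_trans _ _ 0) ?ltrN10 ?ltr01.
have : f p = 1.
  apply: fW; apply/WE; split => //; exists p, 1%N; split; rewrite ?prime_gt0 ?coprimen1 ?muln1 //.
  by move=> p' pp'; rewrite dvdn_prime2 // => /eqP ->; rewrite cp.
by rewrite fp => /eqP; rewrite lt_eqF // (@lt_trans _ _ 0) ?ltrN10 ?ltr01.
Qed.

(** Here [d] is [t / N] modulo [q], where [q] divides [t^2 + N]. The shape [d^2 N + 1] is the one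
    that lets the last border reach determinant 1. *)
Theorem exists_negsq_modulus N r : (N %% 4 = 1)%N -> coprime N r ->
  exists q s (d : int), [/\ (0 < q)%N, q = (r * s ^ 2)%N %[mod N] & (q %| d ^+ 2 * N + 1)%Z].
Proof.
move=> N4 cNr; have [q [s [q0 qE gq]]] := residue_class_split_prime N4 cNr.
have hq p : prime p -> (p %| q)%N -> [/\ odd p, coprime p N & exists t, (p %| t ^ 2 + N)%N].
  move=> pp pq; have /andP[cp sp] := gq _ pp pq.
  have := cp; rewrite coprimeMl coprime4n => /andP[op cNp].
  by rewrite coprime_sym; split => //; apply: negsq_symbolP.
have [t tq] := negsq_lift q0 hq.
have N_gt0 : (0 < N)%N by lia.
have cqN : coprimez N q.
  rewrite coprimezE /= /coprime eqn_leq gcdn_gt0 N_gt0 andbT leqNgt; apply/negP => d1.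
  have [dN dq] := (dvdn_gcdl N q, dvdn_gcdr N q).
  have [_ + _] := hq _ (pdiv_prime d1) (dvdn_trans (pdiv_dvd _) dq).
  rewrite prime_coprime ?pdiv_prime // => /negP; apply; exact: dvdn_trans (pdiv_dvd _) dN.
have [[u v] /= uv] := coprimezP _ _ cqN.
exists q, s, (u * t); split => //.
rewrite -(@Gauss_dvdzr q N%:Z) 1?coprimez_sym //.
have uE : u * N%:Z = 1 - v * q%:Z by apply: (addIr (v * q%:Z)); rewrite uv subrK.
have -> : N%:Z * ((u * t) ^+ 2 * N%:Z + 1) = (u * N%:Z) ^+ 2 * t ^+ 2 + N%:Z by ring.
have -> : (u * N%:Z) ^+ 2 * t ^+ 2 + N%:Z =
    t ^+ 2 + N%:Z + q%:Z * ((v ^+ 2 * q%:Z - 2 * v) * t ^+ 2) by rewrite uE; ring.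
by rewrite rpredD // dvdz_mulr.
Qed.

(** * Positive definite integral forms and Hermite's inequality *)

Definition qform (R : comNzRingType) n (A : 'M[R]_n) (x : 'rV_n) : R :=
  (x *m A *m x^T) 0 0.

Definition posdef n (A : 'M[int]_n) : Prop :=
  A^T = A /\ forall x : 'rV_n, x != 0 -> 0 < qform A x.

Lemma qform_congr (R : comNzRingType) m n (P : 'M[R]_(m, n)) (A : 'M[R]_n) (x : 'rV_m) :
  qform (P *m A *m P^T) x = qform A (x *m P).
Proof. by rewrite /qform trmx_mul !mulmxA. Qed.

Lemma qformZ (R : comNzRingType) n (A : 'M[R]_n) (c : R) (x : 'rV_n) :
  qform A (c *: x) = c ^+ 2 * qform A x.
Proof.
by rewrite /qform linearZ /= -scalemxAr -!scalemxAl scalerA mxE expr2.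
Qed.

Lemma qform0 (R : comNzRingType) n (A : 'M[R]_n) : qform A 0 = 0.
Proof. by rewrite /qform !mul0mx mxE. Qed.

Lemma posdef_congr m n (P : 'M[int]_(m, n)) (A : 'M_n) :
  (forall x : 'rV_m, x *m P = 0 -> x = 0) -> posdef A -> posdef (P *m A *m P^T).
Proof.
move=> injP [symA posA]; split; first by rewrite !trmx_mul trmxK symA mulmxA.
move=> x x0; rewrite qform_congr; apply: posA.
by apply: contraNneq x0 => /injP ->.
Qed.

Lemma unitmx_row_inj n (U : 'M[int]_n) (x : 'rV_n) :
  U \in unitmx -> x *m U = 0 -> x = 0.
Proof. by move=> Uu xU; rewrite -(mulmxK Uu x) xU mul0mx. Qed.

Lemma posdef_unit_congr n (U A : 'M[int]_n) :
  U \in unitmx -> posdef A -> posdef (U *m A *m U^T).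
Proof. by move=> Uu; apply: posdef_congr => x; apply: unitmx_row_inj. Qed.

Lemma unitz_sqr (z : int) : (z \is a GRing.unit) = (z ^+ 2 == 1).
Proof. by rewrite sqrf_eq1; case: z => [[|[|n]]|[|n]]. Qed.

Lemma det_unit_congr n (U A : 'M[int]_n) :
  U \in unitmx -> \det (U *m A *m U^T) = \det A.
Proof.
rewrite unitmxE => dU; rewrite !det_mulmx det_tr mulrC mulrA -expr2.
by move: dU; rewrite unitz_sqr => /eqP ->; rewrite mul1r.
Qed.

(** Smith normal form of a single row: a multiple of a primitive vector, which is completed to a
    basis. *)
Lemma rV_factor n (x : 'rV[int]_n.+1) :
  exists d, exists2 U : 'M[int]_n.+1, U \in unitmx & x = d *: row 0 U.
Proof.
have [L Lu [U Uu [d _ ->]]] := int_Smith_normal_form x.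
exists (L 0 0 * d`_0), U => //.
apply/rowP => j; rewrite -mulmxA mxE big_ord1 !mxE -mulrA; congr (_ * _).
rewrite (bigD1 0) //= big1 ?addr0 => [|k /negPf k0]; first by rewrite mxE eqxx mulr1n.
by rewrite mxE -[X in _ *+ X]/(nat_of_bool (0%N == k :> nat)) eq_sym
  (k0 : (k == 0%N :> nat) = false) mul0r.
Qed.

Lemma posdef_min n (A : 'M[int]_n.+1) : posdef A ->
  exists2 x : 'rV_n.+1, x != 0 & forall y, y != 0 -> qform A x <= qform A y.
Proof.
move=> [_ posA].
pose P k := exists2 x : 'rV_n.+1, x != 0 & qform A x = k%:Z.
have exP : exists k, P k.
  pose e : 'rV[int]_n.+1 := delta_mx 0 0.
  have e0 : e != 0 by apply/eqP => /matrixP/(_ 0 0); rewrite !mxE !eqxx.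
  by exists `|qform A e|%N, e => //; rewrite gez0_abs // ltW // posA.
suff [k [x x0 xk] kmin] : exists2 k, P k & forall j, P j -> (k <= j)%N.
  exists x => // y y0; rewrite xk.
  have qy := ltW (posA y y0); rewrite -(gez0_abs qy) lez_nat.
  by apply: kmin; exists y => //; rewrite gez0_abs.
case: exP => k; elim/ltn_ind: k => k IH Pk.
have [[j jk Pj]|noj] := boolp.pselect (exists2 j, (j < k)%N & P j).
  exact: IH jk Pj.
exists k => // j Pj; rewrite leqNgt; apply/negP => jk; apply: noj; by exists j.
Qed.

(** Completion of the square, multiplied by [m] so as to stay over the integers; [m *: C - b^T *m b]
    is [m] times the Schur complement. *)
Lemma qform_block n (m : int) (b : 'rV[int]_n) (C : 'M_n) (t : int) (y : 'rV_n) :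
  m * qform (block_mx m%:M b b^T C) (row_mx t%:M y) =
  (m * t + (b *m y^T) 0 0) ^+ 2 + qform (m *: C - b^T *m b) y.
Proof.
rewrite /qform tr_row_mx mul_row_block mul_row_col tr_scalar_mx.
rewrite !mulmxDl mulmxBr mulmxBl -scalar_mxM.
have yb : y *m b^T = ((b *m y^T) 0 0)%:M.
  by rewrite [LHS]mx11_scalar -[y *m _]trmxK trmx_mul trmxK mxE.
rewrite mulmxA yb -!mulmxA -(scalemxAl m) -(scalemxAr m) !mul_scalar_mx.
rewrite [X in _ + (X + _)]mx11_scalar (mx11_scalar (y *m (C *m y^T))) (mx11_scalar (b *m y^T)) !mxE.
rewrite !eqxx !mulr1n; set s := \sum_j _; set q := \sum_j _.
ring.
Qed.

Lemma det_block_schur n (m : int) (b : 'rV[int]_n) (C : 'M_n) :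
  m ^+ n * \det (block_mx m%:M b b^T C) = m * \det (m *: C - b^T *m b).
Proof.
have <- : \det (block_mx 1%:M 0 (- b^T) (m%:M : 'M_n)) = m ^+ n.
  by rewrite det_lblock det1 mul1r det_scalar.
rewrite -det_mulmx mulmx_block !mul1mx !mul0mx !addr0.
by rewrite mul_mx_scalar !mul_scalar_mx scalerN addNr det_ublock det_scalar1 mulNmx addrC.
Qed.

(** A minimal vector is a nonzero multiple of the first row of some unimodular [U], and that row has
    no larger value; it becomes the first basis vector. *)
Lemma posdef_split n (A : 'M[int]_n.+1) : posdef A ->
  exists (m : int) (b : 'rV[int]_n) (C : 'M_n), exists2 U : 'M_(1 + n), U \in unitmx &
  let B := block_mx m%:M b b^T C in
  [/\ 0 < m, U *m A *m U^T = B, posdef B & forall y, y != 0 -> m <= qform B y].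
Proof.
move=> pdA; have [x x0 xmin] := posdef_min pdA.
have [d [U Uu xE]] := rV_factor x.
have r0 : row 0 U != 0 by apply: contraNneq x0; rewrite xE => ->; rewrite scaler0.
pose B : 'M_(1 + n) := U *m A *m U^T.
have pdB : posdef B := posdef_unit_congr Uu pdA.
have qE : qform A (row 0 U) = ulsubmx B 0 0.
  by rewrite -[qform _ _]/(_ 0 0) !mxE; apply: eq_bigr => k _; rewrite !mxE lshift0;
     congr (_ * _); apply: eq_bigr => j _; rewrite !mxE.
have BE : B = block_mx (qform A (row 0 U))%:M (ursubmx B) (ursubmx B)^T (drsubmx B).
  by rewrite -[LHS](submxK B) [ulsubmx B]mx11_scalar -qE trmx_ursub pdB.1.
exists (qform A (row 0 U)), (ursubmx B), (drsubmx B), U => //=.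
rewrite -BE; split => // [|y y0]; first exact: pdA.2.
have yU0 : y *m U != 0 by apply: contraNneq y0 => /(unitmx_row_inj Uu) ->.
rewrite qform_congr; apply: le_trans (xmin _ yU0); rewrite xE qformZ.
rewrite ler_peMl ?(ltW (pdA.2 _ r0)) //.
have: d != 0 by apply: contraNneq x0; rewrite xE => ->; rewrite scale0r.
by move: (d) => e; nia.
Qed.

Lemma row_mx_neq0 n (t : int) (y : 'rV[int]_n) : y != 0 -> row_mx t%:M y != 0.
Proof. by apply: contraNneq; rewrite -[0]row_mx0 => /eq_row_mx[_ ->]. Qed.

Lemma posdef_schur n (m : int) (b : 'rV_n) (C : 'M_n) : 0 < m ->
  posdef (block_mx m%:M b b^T C) -> posdef (m *: C - b^T *m b).
Proof.
move=> m0 [symB posB]; move: symB; rewrite tr_block_mx => /eq_block_mx[_ _ _ symC].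
split; first by rewrite linearB linearZ /= symC trmx_mul trmxK.
move=> y y0; pose s := (b *m y^T) 0 0.
have my0 : m *: y != 0 by rewrite scalemx_eq0 negb_or gt_eqF.
(* These coordinates cancel the square in [qform_block]. *)
have := qform_block m b C (- s) (m *: y).
have -> : (b *m (m *: y)^T) 0 0 = m * s by rewrite linearZ -scalemxAr mxE.
rewrite qformZ mulrN addNr expr0n add0r => E.
have := posB _ (row_mx_neq0 (- s) my0).
by rewrite -(pmulr_rgt0 _ m0) E pmulr_rgt0 // exprn_gt0.
Qed.

Lemma centered_rem (m s : int) : 0 < m -> exists t, `|2 * (m * t + s)| <= m.
Proof.
move=> m0; exists (- ((2 * s + m) %/ (2 * m))%Z).
have m2 : 2 * m != 0 by lia.
have := divz_eq (2 * s + m) (2 * m); have := modz_ge0 (2 * s + m) m2.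
have := @ltz_pmod (2 * s + m) (2 * m) ltac:(lia).
set q := (_ %/ _)%Z; set r := (_ %% _)%Z => *; lia.
Qed.

(** A first coordinate [t] can be chosen with [u = m t + b y] at most [m / 2] in absolute value;
    then [m^2] is at most [u^2] plus the value of the complement at [y]. *)
Lemma schur_min_bound n (m : int) (b : 'rV_n) (C : 'M_n) : 0 < m ->
  (forall x, x != 0 -> m <= qform (block_mx m%:M b b^T C) x) ->
  forall y, y != 0 -> 3 * m ^+ 2 <= 4 * qform (m *: C - b^T *m b) y.
Proof.
move=> m0 minB y y0; have [t ht] := centered_rem ((b *m y^T) 0 0) m0.
have := minB _ (row_mx_neq0 t y0); have := qform_block m b C t y.
move: ht; set s := (b *m _) 0 0; set u := m * t + s.
set Q := qform _ y; set P := qform _ (row_mx _ _) => hu E hP.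
have hu2 : 4 * u ^+ 2 <= m ^+ 2 by nia.
have : m ^+ 2 <= m * P by nia.
lia.
Qed.

Lemma posdef_minE n (m : int) (b : 'rV_n) (C : 'M_n) :
  qform (block_mx m%:M b b^T C) (row_mx 1%:M 0) = m.
Proof.
by rewrite /qform tr_row_mx mul_row_block mul_row_col !mul0mx !addr0 !trmx0 mulmx0
   addr0 tr_scalar_mx mul1mx mulmx1 mxE eqxx mulr1n.
Qed.

(** In rank [r], the bound [(4/3)^((r-1)/2) det^(1/r)] raised to the power [r] and cleared of
    denominators. The induction passes to the complement of a minimal vector, whose determinant is
    known and whose values are at least [3 m^2 / 4]. *)
Lemma hermite n (A : 'M[int]_n.+1) : posdef A ->
  exists2 x : 'rV_n.+1, x != 0 &
    qform A x ^+ n.+1 * 3 ^+ 'C(n.+1, 2) <= 4 ^+ 'C(n.+1, 2) * \det A.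
Proof.
elim: n A => [|n IH] A pdA.
  exists 1%:M; first by apply/eqP => /matrixP/(_ 0 0); rewrite !mxE.
  rewrite /qform mul1mx trmx1 mulmx1 bin_small // !expr0 mulr1 mul1r expr1.
  by rewrite [X in \det X]mx11_scalar det_scalar1.
have [m [b [C [U Uu /= [m0 UA pdB minB]]]]] := posdef_split pdA.
exists (row_mx 1%:M 0 *m U).
  apply/eqP => /(unitmx_row_inj Uu) /matrixP/(_ 0 0); rewrite [LHS]mxE.
  by case: splitP => // j; rewrite !mxE (ord1 j).
have -> : qform A (row_mx 1%:M 0 *m U) = m by rewrite -qform_congr UA posdef_minE.
have [y y0] := IH _ (posdef_schur m0 pdB).
have := schur_min_bound m0 minB y0; set M := qform _ y.
have detE : \det (m *: C - b^T *m b) = m ^+ n * \det A.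
  have := det_block_schur m b C; rewrite -UA det_unit_congr // exprS -mulrA.
  by move/(mulfI (lt0r_neq0 m0)) => ->.
rewrite detE (binS n.+1 1) bin1; set c := 'C(_, _) => hM hI.
have m0' := ltW m0.
rewrite -(ler_pM2l (exprn_gt0 n m0)).
have -> : m ^+ n * (m ^+ n.+2 * 3 ^+ (c + n.+1)) = (3 * m ^+ 2) ^+ n.+1 * 3 ^+ c.
  by rewrite exprMn -exprM (_ : (2 * n.+1 = n + n.+2)%N) ?exprD; [ring | lia].
apply: (@le_trans _ _ ((4 * M) ^+ n.+1 * 3 ^+ c)).
  rewrite ler_pM2r ?exprn_gt0 // lerXn2r ?nnegrE //; lia.
have -> : (4 * M) ^+ n.+1 * 3 ^+ c = 4 ^+ n.+1 * (M ^+ n.+1 * 3 ^+ c).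
  by rewrite exprMn mulrA.
have -> : m ^+ n * (4 ^+ (c + n.+1) * \det A) = 4 ^+ n.+1 * (4 ^+ c * (m ^+ n * \det A)).
  by rewrite exprD; ring.
by rewrite ler_pM2l ?exprn_gt0.
Qed.

(** * Unimodular forms of rank at most 6 *)

Lemma det_schur n (m : int) (b : 'rV_n.+1) (C : 'M_n.+1) : m != 0 ->
  \det (m *: C - b^T *m b) = m ^+ n * \det (block_mx m%:M b b^T C).
Proof.
move=> m0; have := det_block_schur m b C; rewrite exprS -mulrA.
by move/(mulfI m0) => ->.
Qed.

(** Up to rank 5, Hermite's constant is at most [(4/3)^2 < 2]. *)
Lemma unimodular_norm1_le5 n (A : 'M[int]_n.+1) : (n < 5)%N ->
  posdef A -> \det A = 1 -> exists x, qform A x = 1.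
Proof.
move=> n5 pdA dA; have [x x0] := hermite pdA; rewrite dA mulr1 => hx.
exists x; have := pdA.2 _ x0; move: hx; set q := qform A x.
move=> hx q0; suff : ~ 2 <= q by lia.
move=> q2; suff : 4 ^+ 'C(n.+1, 2) < q ^+ n.+1 * 3 ^+ 'C(n.+1, 2) :> int by lia.
apply: (@lt_le_trans _ _ (2 ^+ n.+1 * 3 ^+ 'C(n.+1, 2))); last first.
  by rewrite ler_pM2r ?exprn_gt0 // lerXn2r ?nnegrE //; lia.
by move: n5; clear; do 5 case: n => [//|n] //.
Qed.

(* Hermite's inequality only shows that the minimum [m] is at most 2. If [m = 2], a second
   reduction leads to a form of rank 5 and minimum 3, and a third one to a form of rank 4
   taking the value 7, which contradicts a congruence modulo 3. *)
Lemma unimodular_norm1_6 (A : 'M[int]_6) :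
  posdef A -> \det A = 1 -> exists x, qform A x = 1.
Proof.
move=> pdA dA.
have [m [b [C [U Uu /= [m0 UA pdB minB]]]]] := posdef_split pdA.
have dB := det_unit_congr A Uu; rewrite UA dA in dB.
suff [x qx] : exists2 x, x != 0 & qform (block_mx m%:M b b^T C) x <= 1.
  move=> qx1; exists (x *m U); rewrite -qform_congr UA.
  by have := pdB.2 _ qx; move: qx1; set q := qform _ _ => *; lia.
have mne0 : m != 0 by rewrite gt_eqF.
have := det_schur b C mne0; rewrite dB mulr1 => dG.
have pdG := posdef_schur m0 pdB.
have [m1|m1] := eqVneq m 1.
  exists (row_mx 1%:M 0); last by rewrite posdef_minE m1.
  by apply/eqP => /matrixP/(_ 0 0); rewrite [LHS]mxE; case: splitP => // j; rewrite !mxE (ord1 j).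
have [y y0] := hermite pdG; rewrite dG (_ : 'C(5, 2) = 10%N) //.
have := schur_min_bound m0 minB y0; set M := qform _ y => hM hI.
(* Hermite's inequality for the complement, of rank 5 and determinant [m^4], combined with
   [3 m^2 <= 4 M], gives [3^15 m^6 <= 4^15]. *)
have m2 : m = 2.
  suff : ~ 3 <= m by lia.
  move=> m3.
  have : (3 * m ^+ 2) ^+ 5 * 3 ^+ 10 <= (4 * M) ^+ 5 * 3 ^+ 10.
    by rewrite ler_pM2r ?exprn_gt0 // lerXn2r ?nnegrE //; lia.
  have -> : (4 * M) ^+ 5 * 3 ^+ 10 = 4 ^+ 5 * (M ^+ 5 * 3 ^+ 10) by ring.
  move=> h1.
  have h2 : (3 * m ^+ 2) ^+ 5 * 3 ^+ 10 <= 4 ^+ 5 * (4 ^+ 10 * m ^+ 4) by lia.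
  have : m ^+ 4 * (m ^+ 6 * 3 ^+ 15) <= m ^+ 4 * 4 ^+ 15 by lia.
  rewrite ler_pM2l ?exprn_gt0 //.
  have : 3 ^+ 6 <= m ^+ 6 by rewrite lerXn2r ?nnegrE //; lia.
  lia.
subst m; move=> {UA dB m1}.
set G := 2 *: C - b^T *m b in dG pdG M hM hI *.
have minG (v : 'rV[int]_5) : v != 0 -> 3 <= qform G v.
  by move=> v0; have := schur_min_bound m0 minB v0; rewrite -/G; set q := qform _ _; lia.
have M3 : M = 3.
  have := minG _ y0; rewrite -/M => M3; suff : ~ 4 <= M by lia.
  move=> M4; have : 4 ^+ 5 <= M ^+ 5 by rewrite lerXn2r ?nnegrE //; lia.
  lia.
have [m' [b' [C' [U' U'u /= [m'0 UG pdB' minB']]]]] := posdef_split pdG.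
have m'3 : m' = 3.
  have le3 : m' <= 3.
    have := minB' (y *m invmx U'); rewrite -UG qform_congr mulmxKV // -/M M3; apply.
    apply: contraNneq y0 => yU; rewrite -(mulmxKV U'u y) yU mul0mx //.
  have := posdef_minE m' b' C'; rewrite -UG qform_congr => mE.
  have : 3 <= m'; last by lia.
  rewrite -mE; apply: minG; apply/eqP => /(unitmx_row_inj U'u) /matrixP/(_ 0 0).
  by rewrite [LHS]mxE; case: splitP => // j; rewrite !mxE (ord1 j).
have dB' := det_unit_congr G U'u; rewrite UG dG in dB'.
subst m'.
(* The second complement has rank 4 and determinant [3^3 2^4], whence [Q <= 7], while [27 <= 4 Q].
   So [3 P = u^2 + 7] with [u] among -1, 0, 1, impossible modulo 3. *)
have := det_schur b' C' (lt0r_neq0 m'0); rewrite dB' => dG'.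
have [z z0] := hermite (posdef_schur m'0 pdB').
rewrite dG' (_ : 'C(4, 2) = 6%N) //.
have [s] := centered_rem ((b' *m z^T) 0 0) m'0.
have := qform_block 3 b' C' s z.
have := schur_min_bound m'0 minB' z0.
set Q := qform _ z; set P := qform _ _; set u := 3 * s + _ => hQ hP hu hI'.
have : Q <= 7.
  suff : ~ 8 <= Q by lia.
  move=> Q8; have : 8 ^+ 4 <= Q ^+ 4 by rewrite lerXn2r ?nnegrE //; lia.
  lia.
nia.
Qed.

(** A vector of norm 1 splits off: with [m = 1] the complement is integral, positive definite and of
    determinant 1. *)
Theorem unimodular_gram n (A : 'M[int]_n) : (n <= 6)%N ->
  posdef A -> \det A = 1 -> exists M : 'M[int]_n, A = M *m M^T.
Proof.
elim: n A => [|n IH] A n6 pdA dA; first by exists A; apply/matrixP => -[].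
have [x qx] : exists x, qform A x = 1.
  have [n5|n5] := ltnP n 5; first exact: unimodular_norm1_le5.
  have nE : n = 5%N by lia.
  by rewrite nE in A pdA dA *; apply: unimodular_norm1_6.
have [m [b [C [U Uu /= [m0 UA pdB minB]]]]] := posdef_split pdA.
have m1 : m = 1.
  have x0 : x != 0 by apply/eqP => x0; rewrite x0 qform0 in qx.
  have := minB (x *m invmx U); rewrite -UA qform_congr mulmxKV // qx.
  suff /[swap] /[apply] : x *m invmx U != 0 by lia.
  by apply: contraNneq x0 => xU; rewrite -(mulmxKV Uu x) xU mul0mx.
subst m.
have dB := det_unit_congr A Uu; rewrite UA dA in dB.
have pdG : posdef (C - b^T *m b) by have := posdef_schur m0 pdB; rewrite scale1r.
have dG : \det (C - b^T *m b) = 1.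
  by have := det_block_schur 1 b C; rewrite dB expr1n !mul1r scale1r => <-.
have [M GM] := IH _ (ltnW n6) pdG dG.
pose X : 'M[int]_(1 + n) := block_mx 1%:M 0 b^T M.
have BE : block_mx 1%:M b b^T C = X *m X^T.
  rewrite tr_block_mx mulmx_block trmx1 trmx0 trmxK.
  by rewrite !mul1mx !mul0mx !mulmx1 !mulmx0 !addr0 -GM addrC subrK.
exists (invmx U *m X); rewrite trmx_mul mulmxA -(mulmxA (invmx U)) -BE -UA.
by rewrite !mulmxA mulVmx // mul1mx -mulmxA -trmx_mul mulVmx // trmx1 mulmx1.
Qed.

(** * Reduction modulo primes *)

Lemma posdef_diag1 n (C : 'M[int]_n) : posdef C -> posdef (block_mx (1%:M : 'M_1) 0 0 C).
Proof.
move=> [symC posC]; split; first by rewrite tr_block_mx trmx1 !trmx0 symC.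
move=> x x0; rewrite -[x]hsubmxK in x0 *; move: (lsubmx x) (rsubmx x) x0 => t y.
rewrite [t]mx11_scalar => x0.
have -> : qform (block_mx 1%:M 0 0 C) (row_mx (t 0 0)%:M y) = t 0 0 ^+ 2 + qform C y.
  rewrite /qform tr_row_mx mul_row_block mul_row_col !mulmx0 addr0 add0r mulmx1.
  by rewrite tr_scalar_mx -scalar_mxM mxE mxE eqxx mulr1n expr2.
have [y0|/posC] := eqVneq y 0; last by have := sqr_ge0 (t 0 0); lia.
rewrite y0 qform0 addr0 exprn_even_gt0 //; apply: contraNneq x0 => ->.
by rewrite y0 raddf0 row_mx0.
Qed.

(** If [x] is isotropic, the form is affine in [k] along [y + k x]; were its slope nonzero, it would
    take negative values. *)
Lemma psd_kernel n (A : 'M[int]_n) x : A^T = A -> (forall y, 0 <= qform A y) ->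
  qform A x = 0 -> x *m A = 0.
Proof.
move=> symA psdA qx; apply/rowP => j; rewrite [RHS]mxE.
pose y : 'rV[int]_n := delta_mx 0 j.
have qE k : qform A (y + k *: x) = qform A y + 2 * k * (x *m A) 0 j.
  rewrite /qform linearD linearZ /= mulmxDl !mulmxDr.
  have e1 : x *m A *m y^T = ((x *m A) 0 j)%:M.
    by rewrite [LHS]mx11_scalar trmx_delta -colE mxE.
  have e2 : y *m A *m x^T = ((x *m A) 0 j)%:M.
    have -> : y *m A *m x^T = (x *m A *m y^T)^T by rewrite !trmx_mul trmxK symA mulmxA.
    by rewrite e1 tr_scalar_mx.
  have e3 : x *m A *m x^T = 0 by rewrite [LHS]mx11_scalar -/(qform A x) qx raddf0.
  rewrite -!scalemxAl -!scalemxAr !mulmxDl -!scalemxAl e1 e2 e3.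
  by rewrite !mxE eqxx !mulr1n; set q := \sum_j _; ring.
have := psdA (y + (- (qform A y + 1) * (x *m A) 0 j) *: x).
rewrite qE; have := psdA y.
set b := (x *m A) 0 j; set q := qform A y; nia.
Qed.

(** An isotropic vector, made primitive, yields a zero row and column. [B] carries a 1 in that
    place, which [P] kills. *)
Lemma psd_posdef n (A : 'M[int]_n) : A^T = A -> (forall x, 0 <= qform A x) ->
  exists (B P : 'M[int]_n), posdef B /\ A = P *m B *m P^T.
Proof.
elim: n A => [|n IH] A symA psdA.
  by exists A, A; split; [split=> // x /eqP []; apply/rowP => -[] | apply/matrixP => -[]].
have [[x x0 qx]|nox] := boolp.pselect (exists2 x, x != 0 & qform A x = 0); last first.
  exists A, 1%:M; rewrite mul1mx trmx1 mulmx1; split => //; split => // x x0.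
  by rewrite lt_neqAle psdA andbT eq_sym; apply/eqP => qx; apply: nox; exists x.
have xA := psd_kernel symA psdA qx.
have [d [U Uu xE]] := rV_factor x.
have d0 : d != 0 by apply: contraNneq x0; rewrite xE => ->; rewrite scale0r.
have yA : row 0 U *m A = 0.
  move: xA; rewrite xE -scalemxAl => /eqP; rewrite scalemx_eq0 (negPf d0) /= => /eqP //.
pose B : 'M_(1 + n) := U *m A *m U^T.
have symB : B^T = B by rewrite /B !trmx_mul trmxK symA mulmxA.
have B0 : usubmx B = 0.
  apply/matrixP => i j; rewrite [LHS]mxE [RHS]mxE [LHS]mxE big1 // => k _.
  have -> : (U *m A) (lshift n i) k = (row 0 U *m A) 0 k.
    rewrite [LHS]mxE [RHS]mxE; apply: eq_bigr => l _; rewrite [in RHS]mxE; congr (U _ _ * _).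
    by apply: val_inj; rewrite /= (ord1 i).
  by rewrite yA mxE mul0r.
have BE : B = block_mx 0 0 0 (drsubmx B).
  rewrite -[LHS]submxK /ulsubmx /ursubmx B0 !linear0.
  by rewrite -[dlsubmx B]trmxK trmx_dlsub symB /ursubmx B0 !linear0.
set C := drsubmx B in BE.
have symC : C^T = C by rewrite /C trmx_drsub symB.
have psdC y : 0 <= qform C y.
  have : 0 <= qform B (row_mx 0 y) by rewrite /B qform_congr.
  rewrite /qform BE tr_row_mx mul_row_block mul_row_col.
  by rewrite !(mul0mx, mulmx0, trmx0, add0r).
have [C' [P [pdC' CE]]] := IH C symC psdC.
exists (block_mx (1%:M : 'M_1) 0 0 C'), (invmx U *m block_mx (0 : 'M_1) 0 0 P).
split; first exact: posdef_diag1.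
have -> : A = invmx U *m B *m (invmx U)^T.
  by rewrite /B !mulmxA mulVmx // mul1mx -mulmxA -trmx_mul mulVmx // trmx1 mulmx1.
set Q := block_mx (0 : 'M_1) 0 0 P; set D := block_mx _ _ _ C'.
have -> : B = Q *m D *m Q^T; last by rewrite trmx_mul !mulmxA.
rewrite BE /Q /D tr_block_mx !mulmx_block !(mul0mx, mulmx0, trmx0, add0r, addr0).
by rewrite -CE.
Qed.

Definition modmx p m n (A : 'M[int]_(m, n)) : 'M['F_p]_(m, n) := map_mx intr A.

Lemma intr_Fp_eq0 p (z : int) : prime p -> (z%:~R == 0 :> 'F_p) = (p %| z)%Z.
Proof. by move=> pp; rewrite (dvdz_pcharf (pchar_Fp pp)). Qed.

Lemma modmx_eq0P p m n (A : 'M[int]_(m, n)) : prime p ->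
  reflect (forall i j, (p %| A i j)%Z) (modmx p A == 0).
Proof.
move=> pp; apply: (iffP eqP) => [/matrixP E i j|H].
  by rewrite -intr_Fp_eq0 //; have := E i j; rewrite !mxE => ->.
by apply/matrixP => i j; rewrite !mxE; apply/eqP; rewrite intr_Fp_eq0.
Qed.

Lemma modmx_lift p m n (x : 'M['F_p]_(m, n)) : exists X, modmx p X = x.
Proof.
exists (map_mx (fun i : 'F_p => (i : nat)%:Z) x).
by apply/matrixP => i j; rewrite !mxE -pmulrn natr_Zp.
Qed.

Lemma modmxM p m n k (A : 'M[int]_(m, n)) (B : 'M_(n, k)) :
  modmx p (A *m B) = modmx p A *m modmx p B.
Proof. exact: map_mxM. Qed.

Lemma qform_modmx p n (A : 'M[int]_n) x : (qform A x)%:~R = qform (modmx p A) (modmx p x).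
Proof. by rewrite /qform /modmx map_trmx -!map_mxM [RHS]mxE. Qed.

Lemma det_posdef n (A : 'M[int]_n.+1) : posdef A -> 0 < \det A.
Proof.
move=> pdA; have [x x0] := hermite pdA; have := pdA.2 _ x0; set q := qform A x => q0.
move=> h; have : 0 < 4 ^+ 'C(n.+1, 2) * \det A.
  by apply: lt_le_trans h; rewrite mulr_gt0 ?exprn_gt0.
by rewrite pmulr_rgt0 ?exprn_gt0.
Qed.

Lemma posdef_congr_inv n (P A : 'M[int]_n) : A^T = A -> \det P != 0 ->
  posdef (P *m A *m P^T) -> posdef A.
Proof.
move=> symA dP [_ posB]; split => // y y0.
have yP0 : y *m \adj P != 0.
  apply: contraNneq y0 => yP; have : (y *m \adj P) *m P = 0 by rewrite yP mul0mx.
  by rewrite -mulmxA mul_adj_mx mul_mx_scalar => /eqP; rewrite scalemx_eq0 (negPf dP).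
have := posB _ yP0; rewrite qform_congr -mulmxA mul_adj_mx mul_mx_scalar qformZ.
by rewrite pmulr_rgt0 // exprn_even_gt0.
Qed.

(** The lifted kernel vector is [d] times the first vector of a basis. As [p] does not divide [d],
    being in the kernel means that [p] divides the first row of the new Gram matrix. *)
Lemma kernel_split p n (A : 'M[int]_n.+1) (x : 'rV_n.+1) : prime p -> A^T = A ->
  modmx p x != 0 -> modmx p x *m modmx p A = 0 ->
  exists (d al : int) (b : 'rV[int]_n) (C : 'M[int]_n), exists2 U : 'M[int]_(1 + n), U \in unitmx &
  [/\ x = d *: row 0 U, ~~ (p %| d)%Z, C^T = C, qform A x = d ^+ 2 * (p%:Z * al) &
      U *m A *m U^T = block_mx (p%:Z * al)%:M (p%:Z *: b) (p%:Z *: b)^T C].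
Proof.
move=> pp symA x0 xA; have [d [U Uu xE]] := rV_factor x.
have pd : ~~ (p %| d)%Z.
  apply: contra x0 => pd; apply/modmx_eq0P => // i j; rewrite xE mxE.
  exact: dvdz_mulr.
pose B : 'M_(1 + n) := U *m A *m U^T.
have symB : B^T = B by rewrite /B !trmx_mul trmxK symA mulmxA.
have cpd : coprimez p d by rewrite coprimezE /= prime_coprime.
have Bp j : (p %| B (lshift n ord0) j)%Z.
  rewrite -(@Gauss_dvdzr p d) //.
  have -> : d * B (lshift n ord0) j = (x *m A *m U^T) 0 j.
    rewrite xE -!scalemxAl [RHS]mxE; congr (_ * _); rewrite [LHS]mxE [RHS]mxE.
    apply: eq_bigr => k _; rewrite [in LHS]mxE [in RHS]mxE; congr (_ * _).
    by apply: eq_bigr => l _; rewrite [in RHS]mxE; congr (U _ _ * _); apply: val_inj.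
  rewrite -intr_Fp_eq0 //; apply/eqP.
  have /matrixP/(_ 0 j) : modmx p (x *m A *m U^T) = 0 by rewrite !modmxM xA mul0mx.
  by rewrite mxE => ->; rewrite mxE.
exists d, (B (lshift n ord0) (lshift n ord0) %/ p)%Z,
  (\row_j (B (lshift n ord0) (rshift 1 j) %/ p)%Z), (drsubmx B), U => //.
have alE : p%:Z * (B (lshift n ord0) (lshift n ord0) %/ p)%Z = B (lshift n ord0) (lshift n ord0).
  by rewrite mulrC divzK.
have bE : p%:Z *: (\row_j (B (lshift n ord0) (rshift 1 j) %/ p)%Z) = ursubmx B.
  apply/rowP => j; rewrite [LHS]mxE [X in _ * X]mxE mulrC divzK //.
  by rewrite [RHS]mxE [RHS]mxE; congr (B _ _); apply: val_inj.
split=> //; first by rewrite trmx_drsub symB.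
  rewrite alE xE qformZ; congr (_ * _).
  rewrite -[qform _ _]/(_ 0 0) [LHS]mxE [RHS]mxE; apply: eq_bigr => k _; rewrite !mxE.
  congr (_ * _); last by congr (U _ _); apply: val_inj.
  by apply: eq_bigr => l _; rewrite !mxE; congr (U _ _ * _); apply: val_inj.
rewrite alE bE -/B -[LHS]submxK trmx_ursub symB; congr block_mx.
by rewrite [LHS]mx11_scalar !mxE.
Qed.

(** Adjoining [x / p] gives an integral overlattice of index [p]: in the basis of [kernel_split] the
    first vector is divided by [p]. *)
Lemma mod_reduce p n (A : 'M[int]_n.+1) (x : 'rV_n.+1) : prime p -> posdef A ->
  modmx p x != 0 -> modmx p x *m modmx p A = 0 -> (p%:Z ^+ 2 %| qform A x)%Z ->
  exists B P : 'M[int]_n.+1, [/\ posdef B, A = P *m B *m P^T & \det A = p%:Z ^+ 2 * \det B].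
Proof.
move=> pp pdA x0 xA; have p0 : p%:Z != 0 by have := prime_gt0 pp; lia.
have [d [al [b [C [U Uu [xE pd symC -> UA]]]]]] := kernel_split pp pdA.1 x0 xA.
have cpd : coprimez p d by rewrite coprimezE /= prime_coprime.
rewrite mulrCA [p%:Z ^+ 2]expr2 dvdz_mul2l // Gauss_dvdzr ?(coprimezXr 2 cpd) // => /dvdzP[al' alE].
pose B : 'M[int]_(1 + n) := block_mx al'%:M b b^T C.
pose D : 'M[int]_(1 + n) := block_mx p%:Z%:M 0 0 1%:M.
have BE : U *m A *m U^T = D *m B *m D^T.
  rewrite UA /D /B tr_block_mx !mulmx_block !trmx0 trmx1 tr_scalar_mx.
  rewrite !(mul0mx, mulmx0, add0r, addr0, mulmx1, mul1mx).
  rewrite -!scalar_mxM mul_scalar_mx mul_mx_scalar alE linearZ /=.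
  by congr (block_mx _%:M _ _ _); ring.
have dD : \det D = p by rewrite det_ublock det1 mulr1 det_scalar1.
have symB : B^T = B by rewrite tr_block_mx tr_scalar_mx trmxK symC.
exists B, (invmx U *m D); split.
- apply: (@posdef_congr_inv _ D); rewrite ?dD // -BE.
  exact: posdef_unit_congr.
- rewrite trmx_mul mulmxA -2!(mulmxA (invmx U)) -BE.
  by rewrite !mulmxA mulVmx // mul1mx -mulmxA -trmx_mul mulVmx // trmx1 mulmx1.
- by rewrite -(det_unit_congr A Uu) BE !det_mulmx det_tr dD mulrAC.
Qed.

(* No [x / p], with [p] prime and [x] not in [p Z^n], can be added to the lattice of Gram
   matrix [A] so as to obtain an integral lattice. *)
Definition square_reduced n (A : 'M[int]_n) := forall p (x : 'rV_n), prime p ->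
  modmx p x != 0 -> modmx p x *m modmx p A = 0 -> ~~ (p%:Z ^+ 2 %| qform A x)%Z.

(** Each enlargement divides the positive determinant by some [p^2], so the process stops. *)
Lemma exists_square_reduced n (A : 'M[int]_n.+1) : posdef A ->
  exists B P : 'M[int]_n.+1, [/\ posdef B, square_reduced B & A = P *m B *m P^T].
Proof.
move: {2}`|\det A|%N (leqnn `|\det A|%N) => k; elim: k A => [|k IH] A dA pdA.
  by have := det_posdef pdA; lia.
have [red|] := boolp.pselect (square_reduced A).
  by exists A, 1%:M; rewrite mul1mx trmx1 mulmx1.
move=> nred.
have [p [x [pp x0 xA qx]]] : exists p (x : 'rV_n.+1), [/\ prime p, modmx p x != 0,
    modmx p x *m modmx p A = 0 & (p%:Z ^+ 2 %| qform A x)%Z].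
  apply: boolp.contrapT => no; apply: nred => p x pp x0 xA; apply/negP => qx.
  by apply: no; exists p, x.
have [B [P [pdB AE dE]]] := mod_reduce pp pdA x0 xA qx.
have [|B' [P' [pdB' redB' BE]]] := IH B _ pdB.
  have := det_posdef pdB; have := prime_gt1 pp; nia.
exists B', (P *m P'); split => //.
by rewrite AE BE trmx_mul !mulmxA.
Qed.

(** Pigeonhole: [al x^2] and [- de - y^2] each take at least [(p + 1) / 2] values. *)
Lemma Fp_sqr_sum p (al de : 'F_p) : prime p -> odd p -> al != 0 ->
  exists x y, al * x ^+ 2 + y ^+ 2 + de = 0.
Proof.
move=> pp op al0; have hp : p = (p./2).*2.+1 by rewrite -[LHS]odd_double_half op.
pose sq (i : nat) : 'F_p := i%:R ^+ 2.
have sq_inj : {in index_iota 0 (p./2).+1 &, injective sq}.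
  move=> i j; rewrite !mem_index_iota => ih jh /eqP.
  rewrite /sq -subr_eq0 subr_sqr mulf_eq0 -natrD.
  rewrite -[(i + j)%:R == 0](dvdn_pcharf (pchar_Fp pp)) => /orP[|/dvdnP[[|k]]]; last 2 first.
  - lia.
  - nia.
  wlog ij : i j ih jh / (j <= i)%N => [W|].
    case: (leqP j i) => [|/ltnW] ij; first exact: W.
    by rewrite -oppr_eq0 opprB => E; apply/esym/(W j i).
  rewrite -natrB // -(dvdn_pcharf (pchar_Fp pp)) => /dvdnP[[|k]]; nia.
pose s := [seq al * sq i | i <- index_iota 0 (p./2).+1].
pose t := [seq - de - sq i | i <- index_iota 0 (p./2).+1].
have us : uniq s.
  by rewrite map_inj_in_uniq ?iota_uniq // => i j ih jh /(mulfI al0) /sq_inj; apply.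
have ut : uniq t.
  by rewrite map_inj_in_uniq ?iota_uniq // => i j ih jh /addrI/oppr_inj /sq_inj; apply.
have : ~~ uniq (s ++ t).
  apply/negP => /card_uniqP E; have := max_card (mem (s ++ t)).
  by rewrite E size_cat !size_map size_iota card_Fp //; lia.
rewrite cat_uniq us ut andbT andTb negbK => /hasP[z /mapP[j _ ->] /mapP[i _ E]].
exists i%:R, j%:R; rewrite -/(sq i) -E /sq; ring.
Qed.

Definition vec3 (R : Type) (a b c : R) : 'rV[R]_3 :=
  \row_j (if j == 0%N :> nat then a else if j == 1%N :> nat then b else c).

Lemma qform3 (R : comNzRingType) (S : 'M[R]_3) a b c : S^T = S ->
  qform S (vec3 a b c) =
  S 0 0 * a ^+ 2 + S 1 1 * b ^+ 2 + S 2 2 * c ^+ 2 + 2 * S 0 1 * a * b + 2 * S 0 2 * a * c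
  + 2 * S 1 2 * b * c.
Proof.
move=> symS; have sym i j : S j i = S i j by rewrite -[in RHS]symS mxE.
rewrite /qform mxE !big_ord_recl big_ord0 !mxE !big_ord_recl !big_ord0 !mxE /=.
have -> : lift ord0 (lift ord0 ord0) = 2 :> 'I_3 by apply: val_inj.
have -> : lift ord0 ord0 = 1 :> 'I_3 by apply: val_inj.
rewrite (sym 0 1) (sym 0 2) (sym 1 2); ring.
Qed.

Lemma vec3_neq0 (R : nzRingType) (a b c : R) : [|| a != 0, b != 0 | c != 0] -> vec3 a b c != 0.
Proof.
rewrite -!negb_and; apply: contra => /eqP/rowP E.
by have := E 0; have := E 1; have := E 2; rewrite !mxE /= => -> -> ->; rewrite eqxx.
Qed.

(** Completing two squares turns [a al q(w, v, 1)] into [al x^2 + y^2] plus a constant, which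
    [Fp_sqr_sum] makes vanish; when [a] or [al] is 0 a zero is explicit. *)
Lemma ternary_isotropic p (S : 'M['F_p]_3) : prime p -> odd p -> S^T = S ->
  exists2 x : 'rV_3, x != 0 & qform S x = 0.
Proof.
move=> pp op symS; set F := 'F_p in S symS *.
pose a := S 0 0; pose b := S 0 1; pose c := S 0 2.
pose al := a * S 1 1 - b ^+ 2; pose be := a * S 1 2 - b * c; pose ga := a * S 2 2 - c ^+ 2.
have [a0|a0] := eqVneq a 0.
  exists (vec3 1 0 0); first by rewrite vec3_neq0 // oner_neq0.
  by rewrite qform3 // -/a a0; ring.
have [al0|al0] := eqVneq al 0.
  exists (vec3 (- b) a 0); first by rewrite vec3_neq0 // a0 orbT.
  apply: (mulfI a0); rewrite mulr0 qform3 // -/a -/b.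
  transitivity (a ^+ 2 * al); last by rewrite al0 mulr0.
  by rewrite /al; ring.
have [x [y xy]] := Fp_sqr_sum (al * ga - be ^+ 2) pp op al0.
pose v := (y - be) / al; pose w := (x - b * v - c) / a.
exists (vec3 w v 1); first by rewrite vec3_neq0 // oner_neq0 !orbT.
apply: (mulfI (mulf_neq0 a0 al0)); rewrite mulr0 -[RHS]xy qform3 // -/a -/b -/c.
have -> : x = a * w + b * v + c by rewrite /w; field.
have -> : y = al * v + be by rewrite /v; field.
by rewrite /al /be /ga; ring.
Qed.

(** If [A = p A0], a zero of [A0] modulo [p] would have a value divisible by [p^2] under [A]. *)
Lemma reduced_modp_neq0 p (A : 'M[int]_3) : prime p -> odd p -> A^T = A ->
  square_reduced A -> modmx p A != 0.
Proof.
move=> pp op symA red; apply/negP => /[dup] /eqP Ap0 /(modmx_eq0P _ pp) Ap.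
pose A0 := map_mx (fun z => (z %/ p)%Z) A.
have AE : A = p%:Z *: A0 by apply/matrixP => i j; rewrite !mxE mulrC divzK.
have symA0 : A0^T = A0 by rewrite /A0 map_trmx symA.
have [|x x0 qx] := @ternary_isotropic p (modmx p A0) pp op.
  by rewrite /modmx map_trmx symA0.
have [X XE] := modmx_lift x.
have := red p X pp; rewrite XE => /(_ x0); rewrite Ap0 mulmx0 => /(_ erefl).
rewrite [A]AE /qform -scalemxAr -scalemxAl mxE -/(qform A0 X) expr2.
rewrite dvdz_mul2l; last by have := prime_gt1 pp; lia.
by rewrite -intr_Fp_eq0 // qform_modmx XE qx eqxx.
Qed.

(** Lifts of [u] and [v] have values 2 modulo 4 and an even inner product. If [u] and [v] differed,
    their sum would be a nonzero kernel vector of value 0 modulo 4. *)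
Lemma reduced_mod2_kernel n (A : 'M[int]_n) (u v : 'rV['F_2]_n) : A^T = A -> square_reduced A ->
  u != 0 -> v != 0 -> u *m modmx 2 A = 0 -> v *m modmx 2 A = 0 -> u = v.
Proof.
move=> symA red u0 v0 uA vA; apply/eqP; apply/negPn/negP => uv.
have [U UE] := modmx_lift u; have [V VE] := modmx_lift v.
have p2 : prime 2 by [].
have F2opp (w : 'rV['F_2]_n) : - w = w.
  apply/rowP => j; rewrite mxE; apply/eqP; rewrite eq_sym -subr_eq0 opprK -mulr2n -mulr_natr.
  by rewrite (pchar_Fp_0 p2) mulr0.
have := red 2%N U p2; rewrite UE => /(_ u0 uA) qU.
have := red 2%N V p2; rewrite VE => /(_ v0 vA) qV.
have := red 2%N (U + V) p2.
have -> : modmx 2 (U + V) = u + v by rewrite /modmx map_mxD -/(modmx 2 U) -/(modmx 2 V) UE VE.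
rewrite -{1}[v]F2opp subr_eq0 => /(_ uv); rewrite mulmxDl uA vA addr0 => /(_ erefl).
have UA j : (2 %| (U *m A) ord0 j)%Z.
  rewrite -(intr_Fp_eq0 _ p2); have /rowP/(_ j) : modmx 2 (U *m A) = 0 by rewrite modmxM UE.
  by rewrite !mxE => ->.
have VA j : (2 %| (V *m A) ord0 j)%Z.
  rewrite -(intr_Fp_eq0 _ p2); have /rowP/(_ j) : modmx 2 (V *m A) = 0 by rewrite modmxM VE.
  by rewrite !mxE => ->.
have ev (W : 'rV[int]_n) (X : 'rV_n) : (forall j, (2 %| (W *m A) ord0 j)%Z) ->
    (2 %| (W *m A *m X^T) ord0 ord0)%Z.
  by move=> WA; rewrite mxE rpred_sum // => j _; rewrite dvdz_mulr.
have -> : qform A (U + V) = qform A U + qform A V + 2 * (U *m A *m V^T) 0 0.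
  have e : (V *m A *m U^T) 0 0 = (U *m A *m V^T) 0 0.
    have -> : V *m A *m U^T = (U *m A *m V^T)^T by rewrite !trmx_mul trmxK symA mulmxA.
    by rewrite mxE.
  rewrite /qform linearD /= !mulmxDl !mulmxDr [LHS]mxE [X in X + _]mxE [X in _ + X]mxE e.
  by move: (_ 0 0) (_ 0 0) ((V *m A *m V^T) 0 0) => x y z; ring.
move: (ev U U UA) (ev V V VA) (ev U V UA) qU qV; rewrite -/(qform A U) -/(qform A V).
by set x := qform A U; set y := qform A V; set z := (_ *m _) 0 0; lia.
Qed.

(** If 4 divided the determinant, the complement of one kernel vector modulo 2 would be singular
    modulo 2 and provide another. *)
Lemma reduced_det_mod4 (A : 'M[int]_3) : posdef A -> square_reduced A -> ~~ (4 %| \det A)%Z.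
Proof.
move=> pdA red; apply/negP => d4; have p2 : prime 2 by [].
have det2 (n : nat) (E : 'M[int]_n) : (2 %| \det E)%Z ->
    exists2 v : 'rV['F_2]_n, v != 0 & v *m modmx 2 E = 0.
  by move=> dE; apply/det0P; rewrite /modmx det_map_mx intr_Fp_eq0.
have [|u u0 uA] := det2 _ A; first by apply: dvdz_trans d4.
have [x xE] := modmx_lift u.
have := kernel_split p2 pdA.1; move=> /(_ x); rewrite xE => /(_ u0 uA).
move=> [d [al [b [C [U Uu [xU pd symC qx UA]]]]]].
have al2 : ~~ (2 %| al)%Z.
  apply/negP => al2; have := red 2%N x p2; rewrite xE qx => /(_ u0 uA) /negP; apply.
  by rewrite mulrCA expr2 dvdz_mul2l // dvdz_mull.
(* Half of the scaled Schur complement; modulo 2 it is [al *: C], with [al] odd. *)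
pose E := al *: C - 2 *: (b^T *m b).
have dE : al * \det A = 2 * \det E.
  have := det_block_schur (2%:Z * al) (2%:Z *: b) C; rewrite -UA det_unit_congr //.
  have -> : (2%:Z * al) *: C - (2%:Z *: b)^T *m (2%:Z *: b) = 2%:Z *: E.
    have -> : (2%:Z *: b)^T = 2%:Z *: b^T by rewrite linearZ.
    by rewrite /E -scalemxAl -scalemxAr scalerBr !scalerA.
  rewrite detZ => h; have al0 : al != 0 by apply: contraNneq al2 => ->.
  have : (4 * al) * (al * \det A) = (4 * al) * (2 * \det E).
    have {h} : (2 * al) ^+ 2 * \det A = 2 * al * (2 ^+ 2 * \det E) := h.
    move: (\det A) (\det E) => D D' h.
    by transitivity ((2 * al) ^+ 2 * D); [ring | rewrite h; ring].
  by apply: mulfI; rewrite mulf_neq0.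
have [|z z0 zE] := det2 _ E.
  by move: d4 dE al2; move: (\det A) (\det E) => D D'; lia.
have zC : z *m modmx 2 C = 0.
  apply/eqP; have : (al%:~R : 'F_2) *: (z *m modmx 2 C) == 0.
    rewrite -zE /E /modmx raddfB /= !map_mxZ.
    by rewrite mulmxBr -!scalemxAr [X in _ - X *: _](_ : _ = 0) ?scale0r ?subr0 //;
       apply/eqP; rewrite intr_Fp_eq0.
  by rewrite scalemx_eq0 intr_Fp_eq0 // (negPf al2).
have mUu : modmx 2 U \in unitmx.
  rewrite unitmxE /modmx det_map_mx unitfE intr_Fp_eq0 //.
  by move: Uu; rewrite unitmxE unitz_sqr; move: (\det U) => D; nia.
(* In the new basis [u] is a multiple of the first vector, whereas [w] has first coordinate 0. *)
pose w : 'rV['F_2]_(1 + 2) := row_mx 0 z.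
have wA : (w *m modmx 2 U) *m modmx 2 A = 0.
  have mUtu : (modmx 2 U)^T \in unitmx by rewrite unitmx_tr.
  have wB : w *m modmx 2 (U *m A *m U^T) = 0.
    rewrite UA /w /modmx map_block_mx mul_row_block !mul0mx !add0r -/(modmx 2 C) zC.
    rewrite (_ : map_mx intr (2%:Z *: b)^T = 0) ?mulmx0 ?row_mx0 //.
    by apply/matrixP => i j; rewrite !mxE; apply/eqP; rewrite intr_Fp_eq0 // dvdz_mulr.
  rewrite -[LHS](mulmxK mUtu) (_ : _ *m (modmx 2 U)^T = 0) ?mul0mx //.
  by rewrite -wB !modmxM !mulmxA; congr (_ *m _); apply: map_trmx.
have w0 : w *m modmx 2 U != 0.
  apply/eqP => wU; have := mulmxK mUu w; rewrite wU mul0mx => w0.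
  by case/negP: z0; move: w0; rewrite /w -[0]row_mx0 => /eq_row_mx[_ <-].
have := reduced_mod2_kernel pdA.1 red u0 w0 uA wA.
have -> : u = row_mx (d%:~R%:M : 'M_1) 0 *m modmx 2 U.
  rewrite -xE xU; apply/rowP => j; rewrite !mxE big_ord_recl big1 => [|k _].
    by rewrite addr0 !mxE; case: splitP => // k; rewrite !mxE (ord1 k) eqxx mulr1n rmorphM.
  rewrite mxE; case: splitP => [k' /= E'|k' _];
    by [have := ltn_ord k'; rewrite -E' | rewrite mxE mul0r].
move/(can_inj (mulmxK mUu)); rewrite /w => /eq_row_mx[_ z0']; by rewrite -z0' eqxx in z0.
Qed.

(** * Bordered matrices and unimodular extensions *)

Definition border (R : pzRingType) n (A : 'M[R]_n) (b : 'rV_n) (c : R) : 'M_(n + 1) :=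
  block_mx A b^T b c%:M.

(** Elimination of the last row, with the adjugate in place of the inverse. *)
Lemma det_border n (A : 'M[int]_n) b c : \det A != 0 ->
  \det (border A b c) = c * \det A - qform (\adj A) b.
Proof.
move=> dA; apply: (mulfI dA).
pose L : 'M[int]_(n + 1) := block_mx 1%:M 0 (- (b *m \adj A)) (\det A)%:M.
have dL : \det L = \det A by rewrite det_lblock det1 mul1r det_scalar1.
rewrite -{1}dL -det_mulmx /L mulmx_block !mul1mx !mul0mx !addr0 mulNmx -mulmxA mul_adj_mx.
rewrite mul_mx_scalar mul_scalar_mx addNr det_ublock; congr (_ * _).
by rewrite mulNmx -scalar_mxM [_ *m b^T]mx11_scalar -/(qform _ _) -raddfN -raddfD /=
  det_scalar1 addrC mulrC.
Qed.

Lemma adj_sym n (A : 'M[int]_n) : A^T = A -> (\adj A)^T = \adj A.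
Proof. by move=> symA; rewrite trmx_adj symA. Qed.

(** With [D = \det A], completing the square writes [D^2] times the bordered form as [qform A u]
    plus [t^2 D] times the new determinant. *)
Lemma posdef_border n (A : 'M[int]_n.+1) b c : posdef A -> 0 < \det (border A b c) ->
  posdef (border A b c).
Proof.
move=> pdA; have D0 := det_posdef pdA; rewrite det_border ?gt_eqF // => dB.
split; first by rewrite /border tr_block_mx pdA.1 trmxK tr_scalar_mx.
move=> x x0; rewrite -[x]hsubmxK in x0 *; move: (lsubmx x) (rsubmx x) x0 => {x} x t.
rewrite [t]mx11_scalar; move: (t 0 0) => {}t x0.
set D := \det A in D0 dB; set k := qform _ b in dB.
pose u := D *: x + t *: (b *m \adj A).
have E : D ^+ 2 * qform (border A b c) (row_mx x t%:M) =
         qform A u + t ^+ 2 * (D * (c * D - k)).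
  have -> : qform (border A b c) (row_mx x t%:M) = qform A x + 2 * t * (x *m b^T) 0 0 + c * t ^+ 2.
    have bx : b *m x^T = ((x *m b^T) 0 0)%:M.
      by rewrite [LHS]mx11_scalar -[b *m x^T]trmxK trmx_mul trmxK mxE.
    rewrite /qform /border tr_row_mx mul_row_block mul_row_col !mulmxDl.
    rewrite -(mulmxA t%:M) bx [x *m b^T]mx11_scalar tr_scalar_mx -!scalar_mxM.
    rewrite mxE [X in X + _]mxE [X in _ + X]mxE.
    by rewrite !mxE !eqxx !mulr1n; ring.
  have -> : qform A u = D ^+ 2 * qform A x + 2 * t * D ^+ 2 * (x *m b^T) 0 0 + t ^+ 2 * (D * k).
    have e1 : u *m A = D *: (x *m A) + (t * D) *: b.
      by rewrite /u mulmxDl -!scalemxAl -mulmxA mul_adj_mx mul_mx_scalar scalerA.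
    have e2 : x *m A *m (b *m \adj A)^T = D *: (x *m b^T).
      by rewrite trmx_mul adj_sym ?pdA.1 // mulmxA -(mulmxA x) mul_mx_adj mul_mx_scalar -scalemxAl.
    have e3 : b *m (b *m \adj A)^T = k%:M.
      by rewrite trmx_mul adj_sym ?pdA.1 // mulmxA [LHS]mx11_scalar.
    have e4 : b *m x^T = ((x *m b^T) 0 0)%:M.
      by rewrite [LHS]mx11_scalar -[b *m x^T]trmxK trmx_mul trmxK mxE.
    rewrite /qform e1 /u linearD !linearZ /= !mulmxDl !mulmxDr -!scalemxAl -!scalemxAr.
    rewrite e2 e3 e4 [x *m A *m x^T]mx11_scalar [x *m b^T]mx11_scalar !mxE !eqxx !mulr1n.
    by ring.
  by ring.
have D2 : 0 < D ^+ 2 by rewrite exprn_gt0.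
rewrite -(pmulr_rgt0 _ D2) E.
have qu : 0 <= qform A u.
  by have [->|/pdA.2/ltW //] := eqVneq u 0; rewrite qform0.
have [t0|t0] := eqVneq t 0; last first.
  by apply: ltr_wpDl => //; apply: mulr_gt0; [rewrite exprn_even_gt0 | exact: mulr_gt0].
rewrite t0 expr0n mul0r addr0 pdA.2 // /u t0 scale0r addr0 scalemx_eq0 gt_eqF //=.
by apply: contraNneq x0 => ->; rewrite t0 raddf0 row_mx0.
Qed.

(** The minor complementary to the corner is [A] itself. It is obtained by solving for the last row
    of the adjugate. *)
Lemma adj_border_last n (A : 'M[int]_n) b c : A^T = A -> \det A != 0 -> \det (border A b c) != 0 ->
  \adj (border A b c) (rshift n 0) (rshift n 0) = \det A.
Proof.
move=> symA dA dB; set B := border A b c in dB *.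
pose z := row (rshift n 0) (\adj B).
have zB : z *m B = row_mx 0 (\det B)%:M.
  rewrite -row_mul mul_adj_mx; apply/rowP => j; rewrite !mxE.
  case: splitP => k kE; rewrite !mxE.
    by rewrite -val_eqE /= kE addn0 gtn_eqF // ltn_ord.
  by rewrite (ord1 k) eqxx; congr (_ *+ _); rewrite -val_eqE /= kE (ord1 k) eqxx.
have zE : \adj B (rshift n 0) (rshift n 0) = (rsubmx z) 0 0 by rewrite !mxE.
rewrite zE; move: zB; rewrite -[z]hsubmxK row_mxKr; move: (lsubmx z) (rsubmx z) => y t.
rewrite [t]mx11_scalar; move: (t 0 0) => {}t; rewrite /B /border mul_row_block => /eq_row_mx[E1 E2].
rewrite mxE eqxx mulr1n; have dBE := det_border b c dA; rewrite -/B in dBE.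
have Dy : \det A *: y = - (t *: (b *m \adj A)).
  have : (y *m A + t%:M *m b) *m \adj A = 0 by rewrite E1 mul0mx.
  rewrite mulmxDl -mulmxA mul_mx_adj mul_mx_scalar mul_scalar_mx -scalemxAl.
  by move/eqP; rewrite addr_eq0 => /eqP.
apply: (mulIf dB).
have /matrixP/(_ 0 0) : \det A *: (y *m b^T + t%:M *m c%:M) = \det A *: (\det B)%:M.
  by rewrite E2.
rewrite scalerDr scalemxAl Dy mulNmx -scalemxAl -scalar_mxM !mxE eqxx !mulr1n => <-.
rewrite dBE /qform [(_ *m b^T) 0 0]mxE; ring.
Qed.

Lemma rank_col_mx_notin (F : fieldType) m n (X : 'M[F]_(m, n)) (r : 'rV_n) :
  ~~ (r <= X)%MS -> \rank (col_mx X r) = (\rank X + 1)%N.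
Proof.
move=> rX; have r0 : r != 0 by apply: contraNneq rX => ->; apply: sub0mx.
have := mxrank_sum_cap X r; rewrite [\rank r]rank_rV r0 => <-.
rewrite (_ : \rank (X :&: r)%MS = 0)%N ?addn0; first by rewrite addsmxE.
apply/eqP; rewrite mxrank_eq0; apply: contraNT rX => cap0.
have rcap : (\rank r <= \rank (X :&: r))%N by rewrite [\rank r]rank_rV r0 lt0n mxrank_eq0.
have := mxrank_leqif_sup (capmxSr X r); rewrite /leqif eqn_leq rcap andbT => -[-> /esym h].
by apply: submx_trans h (capmxSl _ _).
Qed.

(** The rank grows by one with the column [v^T], by symmetry of [S], and by one with the last
    row. *)
Lemma rank_border (F : fieldType) n (S : 'M[F]_n) (v : 'rV_n) (c : 'M_1) : S^T = S ->
  ~~ (v <= S)%MS -> \rank (block_mx S v^T v c) = (\rank S + 2)%N.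
Proof.
move=> symS vS; rewrite block_mxEv rank_col_mx_notin.
  by rewrite -mxrank_tr tr_row_mx trmxK symS rank_col_mx_notin // -addnA.
apply: contra vS => /submxP[D]; rewrite mul_mx_row => /eq_row_mx[-> _].
exact: submxMl.
Qed.

Lemma rank_border_ge (F : fieldType) n (S : 'M[F]_n) (v : 'rV_n) (c : 'M_1) :
  (\rank S <= \rank (block_mx S v^T v c))%N.
Proof.
have E : S = row_mx 1%:M 0 *m block_mx S v^T v c *m col_mx 1%:M 0.
  by rewrite mul_row_block mul_row_col !mul0mx !addr0 mulmx0 addr0 mul1mx mulmx1.
rewrite {1}E; exact: leq_trans (mxrankM_maxl _ _) (mxrankM_maxr _ _).
Qed.

Lemma modmx_border p n (A : 'M[int]_n) b c :
  modmx p (border A b c) = block_mx (modmx p A) (modmx p b)^T (modmx p b) (c%:~R)%:M.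
Proof. by rewrite /modmx /border map_block_mx map_scalar_mx map_trmx. Qed.

(** * Choice of the borders *)

Lemma crt_rV n (P : forall p, 'rV['F_p]_n -> Prop) (s : seq nat) : uniq s -> all prime s ->
  (forall p, p \in s -> exists x, P p x) ->
  exists x : 'rV[int]_n, forall p, p \in s -> P p (modmx p x).
Proof.
elim: s => [|p s IH] /=; first by exists 0.
move=> /andP[ps us] /andP[pp prs] H.
have [|x xP] := IH us prs; first by move=> q qs; apply: H; rewrite inE qs orbT.
have [|y yP] := H p; first by rewrite inE eqxx.
have [Y YE] := modmx_lift y.
pose m := (\prod_(q <- s) q)%N.
have cmp : coprimez m p.
  rewrite coprimezE /= coprime_sym prime_coprime // /m big_seq.
  elim/big_ind: _ => [|a b pa pb|q qs].
  - by rewrite dvdn1; apply: contraTN pp => /eqP ->.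
  - by rewrite Euclid_dvdM // negb_or pa.
  - rewrite dvdn_prime2 //; first by apply: contraNneq ps => ->.
    exact: (allP prs).
have [[k l] /= kl] := coprimezP _ _ cmp.
(* The factor [k m] is 1 modulo [p] and 0 modulo the primes of [s]. *)
exists (x + (k * m%:Z) *: (Y - x)) => q; rewrite inE => /orP[/eqP ->|qs].
  suff -> : modmx p (x + (k * m%:Z) *: (Y - x)) = y by [].
  rewrite -YE; apply/rowP => j; rewrite !mxE.
  apply/eqP; rewrite -subr_eq0 -intrB intr_Fp_eq0 //.
  apply/dvdzP; exists (l * (x 0 j - Y 0 j)).
  have -> : l * (x 0 j - Y 0 j) * p%:Z = (l * p%:Z) * (x 0 j - Y 0 j) by ring.
  have -> : l * p%:Z = 1 - k * m%:Z by apply: (addrI (k * m%:Z)); rewrite kl addrCA subrr addr0.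
  by ring.
suff -> : modmx q (x + (k * m%:Z) *: (Y - x)) = modmx q x by exact: xP.
apply/rowP => j; rewrite !mxE; apply/eqP; rewrite -subr_eq0 -intrB intr_Fp_eq0 ?(allP prs) //.
rewrite addrAC subrr add0r dvdz_mulr // dvdz_mull //.
rewrite /m (big_rem q) //= -[(_ \in _)]/(q %| _)%N; exact: dvdn_mulr.
Qed.

Lemma not_full_notin (F : fieldType) n (S : 'M[F]_n) : (\rank S < n)%N ->
  exists v : 'rV_n, ~~ (v <= S)%MS.
Proof.
move=> rS; have /row_subPn[i ri] : ~~ (1%:M <= S)%MS.
  by apply: contraL rS => /mxrankS; rewrite mxrank1 -leqNgt.
by exists (row i 1%:M).
Qed.

Lemma det_modp p n (A : 'M[int]_n) : prime p -> (p %| \det A)%Z = (\rank (modmx p A) < n)%N.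
Proof.
move=> pp; rewrite -intr_Fp_eq0 // -det_map_mx -/(modmx p A).
rewrite ltn_neqAle rank_leq_row andbT -[_ == n]/(row_free _) row_free_unit unitmxE unitfE.
by rewrite negbK.
Qed.

(** Such a row raises the rank by 2 modulo every prime dividing the determinant. *)
Lemma exists_border_row n (A : 'M[int]_n) : \det A != 0 ->
  exists b : 'rV[int]_n, forall p, prime p -> (p %| \det A)%Z -> ~~ (modmx p b <= modmx p A)%MS.
Proof.
move=> dA; pose P (p : nat) (v : 'rV['F_p]_n) : Prop := is_true (~~ (v <= modmx p A)%MS).
have [||p|b bP] := @crt_rV n P (primes `|\det A|%N).
- exact: primes_uniq.
- by apply/allP => p; rewrite mem_primes => /andP[].
- rewrite mem_primes => /and3P[pp _ pd]; apply: not_full_notin.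
  by rewrite -det_modp.
exists b => p pp pd; apply: bP; rewrite mem_primes pp absz_gt0 dA; exact: pd.
Qed.

Lemma qform_delta (R : comNzRingType) n (A : 'M[R]_n) i : qform A (delta_mx 0 i) = A i i.
Proof. by rewrite /qform -rowE trmx_delta -colE !mxE. Qed.

(** Some multiple of [D] is [k + 1] modulo 4, since [D] is odd, or [D] is 2 modulo 4 and [k] is odd;
    adding a large multiple of 4 to the coefficient gives positivity. *)
Lemma choose_mod4 (D k : int) : 0 < D -> ~~ (4 %| D)%Z ->
  ((2 %| D)%Z -> ~~ (2 %| k)%Z) ->
  exists c, 0 < c * D - k /\ (4 %| c * D - k - 1)%Z.
Proof.
move=> D0 D4 k2; pose e := (`|k| + 1) * D.
have eP j : 0 <= j -> 0 < (4 * (`|k| + 1) + j) * D - k.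
  by move=> j0; have := normr_ge0 k; have := ler_norm k; nia.
have E j : (4 * (`|k| + 1) + j) * D - k - 1 = 4 * e + (j * D - k - 1) by rewrite /e; ring.
have : exists2 j : int, 0 <= j & (4 %| j * D - k - 1)%Z.
  have : exists2 j : int, 0 <= j <= 3 & (4 %| j * D - k - 1)%Z; last first.
    by move=> [j /andP[]]; exists j.
  have [h|[h|[h|h]]] : (4 %| 0 * D - k - 1)%Z \/ (4 %| 1 * D - k - 1)%Z \/
     (4 %| 2 * D - k - 1)%Z \/ (4 %| 3 * D - k - 1)%Z by lia.
  - by exists 0.
  - by exists 1.
  - by exists 2.
  - by exists 3.
move=> [j j0 jD]; exists (4 * (`|k| + 1) + j); split; first exact: eP.
by rewrite E rpredD // dvdz_mulr.
Qed.

Lemma reduced_rank_mod2 (A : 'M[int]_3) : A^T = A -> square_reduced A ->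
  (2 <= \rank (modmx 2 A))%N.
Proof.
move=> symA red; rewrite leqNgt; apply/negP => r1.
have rk := mxrank_ker (modmx 2 A).
have k0 : kermx (modmx 2 A) != 0 by rewrite -mxrank_eq0 rk; lia.
have [i ui] : exists i, row i (kermx (modmx 2 A)) != 0.
  apply/existsP; apply: contraNT k0; rewrite negb_exists => /forallP H.
  by apply/eqP/row_matrixP => i; rewrite row0; apply/eqP/negbNE/H.
have rA j : row j (kermx (modmx 2 A)) *m modmx 2 A = 0 by rewrite -row_mul mulmx_ker row0.
have : (kermx (modmx 2 A) <= row i (kermx (modmx 2 A)))%MS.
  apply/row_subP => j; have [->|uj] := eqVneq (row j (kermx (modmx 2 A))) 0; first exact: sub0mx.
  by rewrite (reduced_mod2_kernel symA red uj ui (rA j) (rA i)).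
by move/mxrankS; rewrite rk rank_rV ui; lia.
Qed.

(** Modulo a prime dividing [\det A], the rank is at least 1, and at least 2 for the prime 2; the
    border adds 2. In particular the new determinant is odd when [\det A] is even, which
    [choose_mod4] requires. *)
Lemma border_det_mod4 (A : 'M[int]_3) : posdef A -> square_reduced A ->
  exists b c, [/\ posdef (border A b c), (4 %| \det (border A b c) - 1)%Z &
    forall p, prime p -> (p %| \det (border A b c))%Z -> (3 <= \rank (modmx p (border A b c)))%N].
Proof.
move=> pdA red; have D0 := det_posdef pdA; have dA : \det A != 0 by rewrite gt_eqF.
have [b bP] := exists_border_row dA.
have symp p : (modmx p A)^T = modmx p A by rewrite /modmx map_trmx pdA.1.
have rk p c : prime p -> (p %| \det A)%Z ->
    \rank (modmx p (border A b c)) = (\rank (modmx p A) + 2)%N.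
  by move=> pp pD; rewrite modmx_border (rank_border _ (symp p) (bP p pp pD)).
have det2 c : (2 %| \det A)%Z -> ~~ (2 %| \det (border A b c))%Z.
  move=> d2; rewrite (@det_modp 2) // rk // -leqNgt.
  by have := reduced_rank_mod2 pdA.1 red; lia.
have [|c [c0 c4]] := choose_mod4 D0 (reduced_det_mod4 pdA red) (k := qform (\adj A) b).
  by move/(det2 0); rewrite det_border // mul0r sub0r rpredN.
exists b, c; split; rewrite ?det_border //.
  by apply: posdef_border; rewrite ?det_border.
move=> p pp; rewrite -det_border // => pB.
have [pA|pA] := boolP (p %| \det A)%Z; last first.
  rewrite modmx_border; apply: leq_trans (rank_border_ge _ _ _).
  by move: pA; rewrite det_modp // -leqNgt.
rewrite rk //; have [op|] := boolP (odd p).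
  suff : (0 < \rank (modmx p A))%N by lia.
  by rewrite lt0n mxrank_eq0 (reduced_modp_neq0 pp op pdA.1 red).
by have := reduced_rank_mod2 pdA.1 red; case: (even_prime pp) => [-> + _|->]; lia.
Qed.

(** With the row [s *: b], the determinant is [c N - s^2 k], where [N = \det A]. It can thus be any
    integer in the class of [- k s^2] modulo [N], and [exists_negsq_modulus] supplies one. *)
Lemma border_negsq n (A : 'M[int]_n.+1) : posdef A -> (4 %| \det A - 1)%Z ->
  (forall p, prime p -> (p %| \det A)%Z -> (n <= \rank (modmx p A))%N) ->
  exists b c d, 0 < \det (border A b c) /\ (\det (border A b c) %| d ^+ 2 * \det A + 1)%Z.
Proof.
move=> pdA d4 rkA; have D0 := det_posdef pdA; have dA : \det A != 0 by rewrite gt_eqF.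
have [b bP] := exists_border_row dA; set k := qform (\adj A) b.
have symp p : (modmx p A)^T = modmx p A by rewrite /modmx map_trmx pdA.1.
(* The border with corner 0 has determinant [- k], and full rank modulo [p]. *)
have pk p : prime p -> (p %| \det A)%Z -> ~~ (p %| k)%Z.
  move=> pp pD; rewrite -rpredN -[- k]add0r -(mul0r (\det A)) -det_border // det_modp // -leqNgt.
  rewrite modmx_border (rank_border _ (symp p) (bP p pp pD)).
  by have := rkA p pp pD; lia.
pose N := `|\det A|%N; have NE : N%:Z = \det A by rewrite /N gtz0_abs.
pose r := `|((- k) %% N)%Z|%N.
have rE : r%:Z = ((- k) %% N)%Z by rewrite gez0_abs // modz_ge0 // NE.
have N0 : (0 < N)%N by rewrite -ltz_nat NE.
have cop : coprime N r.
  rewrite /coprime eqn_leq gcdn_gt0 N0 andbT leqNgt; apply/negP => g1.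
  have pp := pdiv_prime g1; have pg := pdiv_dvd (gcdn N r).
  set p := pdiv _ in pp pg.
  have pN : (p %| \det A)%Z by rewrite -NE; exact: dvdn_trans pg (dvdn_gcdl _ _).
  have pr : (p %| r%:Z)%Z by exact: dvdn_trans pg (dvdn_gcdr _ _).
  have /negP := pk p pp pN; apply; rewrite -rpredN (divz_eq (- k) N) rpredD // -?rE //.
  by rewrite NE dvdz_mull.
have N4 : (N %% 4 = 1)%N by move: d4; rewrite -NE; lia.
have [q [s [d [q0 qE qd]]]] := exists_negsq_modulus N4 cop.
have : (N %| q%:Z + s%:Z ^+ 2 * k)%Z.
  have /eqP : (q%:Z = (r * s ^ 2)%N%:Z %[mod N])%Z by rewrite !modz_nat qE.
  rewrite eqz_mod_dvd => h1.
  have h2 : (N %| r%:Z + k)%Z.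
    by rewrite rE -[X in _ + X]opprK -eqz_mod_dvd modz_mod.
  have -> : q%:Z + s%:Z ^+ 2 * k = (q%:Z - (r * s ^ 2)%N%:Z) + s%:Z ^+ 2 * (r%:Z + k).
    by rewrite PoszM -mulnn PoszM; ring.
  by rewrite rpredD // dvdz_mull.
move=> /dvdzP[c cE]; exists (s%:Z *: b), c, d.
have -> : \det (border A (s%:Z *: b) c) = q.
  by rewrite det_border // qformZ -/k -NE -cE addrK.
by rewrite -NE ltz_nat.
Qed.

(** Let [q] be the determinant of the first border. With [d] times the last unit vector as row,
    [adj_border_last] gives the determinant [e q - d^2 \det A], and [e] is the quotient of
    [d^2 \det A + 1] by [q]. *)
Lemma border_unimodular n (A : 'M[int]_n.+1) : posdef A -> (4 %| \det A - 1)%Z ->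
  (forall p, prime p -> (p %| \det A)%Z -> (n <= \rank (modmx p A))%N) ->
  exists b c b' c', let B := border (border A b c) b' c' in posdef B /\ \det B = 1.
Proof.
move=> pdA d4 rkA; have [b [c [d [q0 /dvdzP[e eE]]]]] := border_negsq pdA d4 rkA.
have dA : \det A != 0 by rewrite gt_eqF // det_posdef.
have pdB := posdef_border pdA q0.
have dB : \det (border A b c) != 0 by rewrite gt_eqF.
pose b' : 'rV[int]_(n.+1 + 1) := d *: delta_mx 0 (rshift _ 0).
exists b, c, b', e => /=.
have d1 : \det (border (border A b c) b' e) = 1.
  rewrite det_border // /b' qformZ qform_delta (adj_border_last pdA.1 dA dB).
  by rewrite -eE addrAC subrr add0r.
by split=> //; apply: (@posdef_border (n + 1)) => //; rewrite d1.
Qed.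

Lemma posdef_ternary_six_squares (A : 'M[int]_3) : posdef A ->
  exists M : 'M[int]_(3, 6), A = M *m M^T.
Proof.
move=> pdA; have [A' [P [pdA' red ->]]] := exists_square_reduced pdA.
have [b [c [pd4 d4 rk4]]] := border_det_mod4 pdA' red.
have [b5 [c5 [b6 [c6 /= [pd6 d6]]]]] := border_unimodular pd4 d4 rk4.
have [M ME] := unimodular_gram (isT : (6 <= 6)%N) pd6 d6.
(* Undoing the three borders keeps the first three rows of [M]. *)
pose N : 'M[int]_(3, 6) := usubmx (usubmx (usubmx (M : 'M_(3 + 1 + 1 + 1, 6)))).
have NE : A' = N *m N^T.
  have sub m k (X : 'M[int]_(m + 1)) (Y : 'M[int]_(m + 1, k)) :
      X = Y *m Y^T -> ulsubmx X = usubmx Y *m (usubmx Y)^T.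
    move=> ->; apply/matrixP => i j; rewrite !mxE; apply: eq_bigr => l _.
    by rewrite !mxE.
  have E5 := sub 5 6 _ (M : 'M_(5 + 1, 6)) ME; rewrite block_mxKul in E5.
  have E4 := sub 4 6 _ (usubmx (M : 'M_(5 + 1, 6)) : 'M_(4 + 1, 6)) E5; rewrite block_mxKul in E4.
  by have := sub 3%N 6 _ _ E4; rewrite block_mxKul.
by exists (P *m N); rewrite trmx_mul NE !mulmxA.
Qed.

Theorem psd_ternary_six_squares (A : 'M[int]_3) : A^T = A -> (forall x, 0 <= qform A x) ->
  exists M : 'M[int]_(3, 6), A = M *m M^T.
Proof.
move=> symA psdA; have [B [P [pdB ->]]] := psd_posdef symA psdA.
have [M ->] := posdef_ternary_six_squares pdB.
by exists (P *m M); rewrite trmx_mul !mulmxA.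
Qed.

(** * A sum of six squares that is not a sum of five *)

(** In the notation of the proof, the sum of the [(B x - D y)^2] is [B (A B - D^2)]. *)
Lemma cauchy_schwarz_int (I : finType) (x y : I -> int) :
  (\sum_i x i * y i) ^+ 2 <= (\sum_i x i ^+ 2) * (\sum_i y i ^+ 2).
Proof.
have gen b d : \sum_i (b * x i - d * y i) ^+ 2 =
    b ^+ 2 * (\sum_i x i ^+ 2) - 2 * b * d * (\sum_i x i * y i) + d ^+ 2 * (\sum_i y i ^+ 2).
  rewrite !mulr_sumr -sumrN -!big_split /=; apply: eq_bigr => i _; ring.
move: gen; set A := \sum_i x i ^+ 2; set B := \sum_i y i ^+ 2; set D := \sum_i x i * y i => gen.
have B0 : 0 <= B by apply: sumr_ge0 => i _; apply: sqr_ge0.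
have : 0 <= \sum_i (B * x i - D * y i) ^+ 2 by apply: sumr_ge0 => i _; apply: sqr_ge0.
have -> : \sum_i (B * x i - D * y i) ^+ 2 = B * (A * B - D ^+ 2).
  by rewrite gen; ring.
have [B00|B00] := eqVneq B 0; last by rewrite pmulr_rge0 ?subr_ge0 // lt0r B00.
have y0 i : y i = 0.
  have : y i ^+ 2 = 0 by apply: (psumr_eq0P _ B00) => // j _; apply: sqr_ge0.
  by move/eqP; rewrite sqrf_eq0 => /eqP.
by move=> _; rewrite /D big1 => [|i _]; rewrite ?y0 ?mulr0 // B00 mulr0.
Qed.

Lemma sum_sqr_eq1 (I : finType) (x : I -> int) : \sum_i x i ^+ 2 = 1 ->
  exists2 i, x i ^+ 2 = 1 & forall j, j != i -> x j = 0.
Proof.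
move=> s1; have /existsP[i xi] : [exists i, x i != 0].
  apply: contraPT isT; rewrite negb_exists => /forallP x0.
  by move: s1; rewrite big1 // => i _; have := x0 i; rewrite negbK => /eqP ->.
move: s1; rewrite (bigD1 i) //=; set r := \sum_(j | j != i) _ => s1.
have r0 : 0 <= r by apply: sumr_ge0 => j _; apply: sqr_ge0.
have x1 : 1 <= x i ^+ 2 by have := sqr_ge0 (x i); have : x i ^+ 2 != 0 by [rewrite sqrf_eq0]; lia.
exists i; first by lia.
have r00 : r = 0 by lia.
move=> j ji; have : x j ^+ 2 = 0 by apply: (psumr_eq0P _ r00) => // l _; apply: sqr_ge0.
by move/eqP; rewrite sqrf_eq0 => /eqP.
Qed.

(** Squares are 0, 1 or 4 modulo 8. *)
Lemma sum_three_sqr_neq7 (s : seq int) : (size s <= 3)%N -> \sum_(x <- s) x ^+ 2 != 7.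
Proof.
have sq8 (x : int) : exists m, x ^+ 2 = 8 * m \/ x ^+ 2 = 8 * m + 1 \/ x ^+ 2 = 8 * m + 4.
  pose q := (x %/ 4)%Z; have xq : x = q * 4 + (x %% 4)%Z := divz_eq x 4.
  have : (x %% 4)%Z \in [:: 0; 1; 2; 3] by rewrite !inE; lia.
  rewrite !inE => /or4P[] /eqP r; rewrite r in xq.
  - by exists (2 * q ^+ 2); left; rewrite xq; ring.
  - by exists (2 * q ^+ 2 + q); right; left; rewrite xq; ring.
  - by exists (2 * q ^+ 2 + 2 * q); right; right; rewrite xq; ring.
  - by exists (2 * q ^+ 2 + 3 * q + 1); right; left; rewrite xq; ring.
case: s => [|x [|y [|z [|//]]]] _; rewrite ?big_cons big_nil ?addr0 //.
- have [m] := sq8 x; move: (x ^+ 2) => X; lia.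
- have [m] := sq8 x; have [n] := sq8 y; move: (x ^+ 2) (y ^+ 2) => X Y; lia.
have [m] := sq8 x; have [n] := sq8 y; have [k] := sq8 z.
move: (x ^+ 2) (y ^+ 2) (z ^+ 2) => X Y Z; lia.
Qed.

(* The left-hand sides are the coordinates of [\sum_i (u i + v i * rho + w i * t) ^+ 2] in
   the basis [1, rho, t], and the right-hand sides those of [7 + (rho - 1)^2 + (t - 1)^2]. *)
Lemma no_five_squares (a : int) k (u v w : 'I_k -> int) : (k <= 5)%N -> 3 <= a ->
  \sum_i (u i ^+ 2 + 2 * v i ^+ 2 + (a + 2) * w i ^+ 2 - 2 * (v i * w i)) = a + 13 ->
  \sum_i ((a + 1) * v i ^+ 2 - w i ^+ 2 + 2 * (u i * v i)) = a - 2 ->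
  \sum_i (v i ^+ 2 + a * w i ^+ 2 + 2 * (u i * w i) - 2 * (v i * w i)) <> a - 1.
Proof.
move=> k5 a3; rewrite !(big_split, sumrN) /= -!mulr_sumr.
have := cauchy_schwarz_int u v; have := cauchy_schwarz_int u w; have := cauchy_schwarz_int v w.
have P0 : 0 <= \sum_i (u i + v i) ^+ 2 by apply: sumr_ge0 => i _; apply: sqr_ge0.
have Q0 : 0 <= \sum_i (v i - w i) ^+ 2 by apply: sumr_ge0 => i _; apply: sqr_ge0.
have Q0' : 0 <= \sum_i (v i + w i) ^+ 2 by apply: sumr_ge0 => i _; apply: sqr_ge0.
have A0 : 0 <= \sum_i u i ^+ 2 by apply: sumr_ge0 => i _; apply: sqr_ge0.
have B0 : 0 <= \sum_i v i ^+ 2 by apply: sumr_ge0 => i _; apply: sqr_ge0.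
have C0 : 0 <= \sum_i w i ^+ 2 by apply: sumr_ge0 => i _; apply: sqr_ge0.
have PE : \sum_i (u i + v i) ^+ 2 = \sum_i u i ^+ 2 + 2 * (\sum_i u i * v i) + \sum_i v i ^+ 2.
  by rewrite mulr_sumr -!big_split; apply: eq_bigr => i _ /=; ring.
have QE : \sum_i (v i - w i) ^+ 2 = \sum_i v i ^+ 2 - 2 * (\sum_i v i * w i) + \sum_i w i ^+ 2.
  by rewrite mulr_sumr -sumrN -!big_split; apply: eq_bigr => i _ /=; ring.
have QE' : \sum_i (v i + w i) ^+ 2 = \sum_i v i ^+ 2 + 2 * (\sum_i v i * w i) + \sum_i w i ^+ 2.
  by rewrite mulr_sumr -!big_split; apply: eq_bigr => i _ /=; ring.
rewrite PE in P0; rewrite QE in Q0; rewrite QE' in Q0'.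
set A := \sum_i u i ^+ 2 in A0 P0 Q0 Q0' PE QE QE' *.
set B := \sum_i v i ^+ 2 in B0 P0 Q0 Q0' PE QE QE' *.
set C := \sum_i w i ^+ 2 in C0 P0 Q0 Q0' PE QE QE' *.
set D := \sum_i u i * v i in P0 PE *.
set E := \sum_i u i * w i.
set F := \sum_i v i * w i in Q0 Q0' QE QE' *.
move=> cF cE cD e1 e2 e3.
(* Parities in the last two equations, for either class of [a]. *)
have [Bodd Codd] : (B %% 2)%Z = 1 /\ (C %% 2)%Z = 1.
  move: e2 e3; have := divz_eq a 2; have := divz_eq B 2; have := divz_eq C 2.
  have ev (x : int) : (x %% 2)%Z = 0 \/ (x %% 2)%Z = 1 by lia.
  have := ev a; have := ev B; have := ev C.
  move: (a %% 2)%Z (a %/ 2)%Z (B %% 2)%Z (B %/ 2)%Z (C %% 2)%Z (C %/ 2)%Z => ra qa rB qB rC qC.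
  by case=> ->; case=> ->; case=> -> -> -> ->; lia.
(* The first two equations add up to [P + Q + (a + 1) B + a C = 2 a + 11], where [P] and [Q] are the
   sums of the [(u + v)^2] and of the [(v - w)^2]. *)
have bound : (a + 1) * B + a * C <= 2 * a + 11 by lia.
have [[B1 C1]|[[B3 C1 a4]|[B1 C3 a5]]] : (B = 1 /\ C = 1) \/
    ([/\ B = 3, C = 1 & a <= 4] \/ [/\ B = 1, C = 3 & a <= 5]).
  have B1 : 1 <= B by lia.
  have C1 : 1 <= C by lia.
  have aB z : z <= B -> (a + 1) * z <= (a + 1) * B by move=> zB; rewrite ler_wpM2l //; lia.
  have aC z : z <= C -> a * z <= a * C by move=> zC; rewrite ler_wpM2l //; lia.
  have B5 : B < 5 by rewrite ltNge; apply/negP => /aB; have := aC _ C1; lia.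
  have C5 : C < 5 by rewrite ltNge; apply/negP => /aC; have := aB _ B1; lia.
  have [B1'|B3] : B = 1 \/ B = 3 by lia.
    have [->|C3] : C = 1 \/ C = 3 by lia.
      by left.
    by right; right; split => //; rewrite B1' C3 in bound; lia.
  have [C1'|C3] : C = 1 \/ C = 3 by lia.
    by right; left; split => //; rewrite B3 C1' in bound; lia.
  by rewrite B3 C3 in bound; lia.
(* If [F] is -1 or 1, then [v] is [- w] or [w], so [D] is [- E] or [E], against the equations. If
   [F = 0], [v] and [w] are supported at distinct indices. *)
- have F1 : F = -1 \/ F = 0 \/ F = 1 by rewrite B1 C1 in cF; nia.
  rewrite B1 C1 in e1 e2 e3 QE QE'.
  have D1 : D = -1 by clear -e2; lia.
  case: F1 => [F1|[F1|F1]]; rewrite F1 in e1 e3 QE QE'.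
  + have vw i : v i = - w i.
      apply/eqP; rewrite -addr_eq0 -sqrf_eq0; apply/eqP.
      by apply: (psumr_eq0P _ QE') => // j _; apply: sqr_ge0.
    have : D = - E by rewrite /D /E -sumrN; apply: eq_bigr => i _; rewrite vw mulrN.
    by lia.
  + have [i vi v0] := sum_sqr_eq1 B1; have [j wj w0] := sum_sqr_eq1 C1.
    have Di : D = u i * v i.
      by rewrite /D (bigD1 i) //= big1 ?addr0 // => l /v0 ->; rewrite mulr0.
    have Ej : E = u j * w j.
      by rewrite /E (bigD1 j) //= big1 ?addr0 // => l /w0 ->; rewrite mulr0.
    have Fi : F = v i * w i.
      by rewrite /F (bigD1 i) //= big1 ?addr0 // => l /v0 ->; rewrite mul0r.
    have ij : j != i.
      apply/eqP => ji; rewrite ji in wj; rewrite F1 in Fi.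
      by have := exprMn 2 (v i) (w i); rewrite -Fi vi wj.
    have ui : u i ^+ 2 = 1 by have := exprMn 2 (u i) (v i); rewrite -Di D1 vi mulr1.
    have E1 : E = -1 by clear -e3; lia.
    have uj : u j ^+ 2 = 1 by have := exprMn 2 (u j) (w j); rewrite -Ej E1 wj mulr1.
    have A9 : A = 9 by clear -e1; lia.
    move: A9; rewrite /A (bigD1 i) //= (bigD1 j) //= ui uj => A9.
    (* At most three indices remain, and their squares sum to [9 - 1 - 1 = 7]. *)
    pose s := [seq u l | l <- enum [pred l | (l != i) && (l != j)]].
    have /sum_three_sqr_neq7/eqP : (size s <= 3)%N.
      rewrite size_map -cardE (eq_card (B := [predC pred2 i j])) => [|l];
        last by rewrite !inE negb_or.
      have := cardC (pred2 i j); rewrite card2 card_ord eq_sym ij /=.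
      by move=> kE; rewrite -(leq_add2l 2) kE.
    have -> : \sum_(x <- s) x ^+ 2 = \sum_(l | (l != i) && (l != j)) u l ^+ 2.
      by rewrite /s big_map big_enum.
    by case; move: A9; clear; move: (\sum_(l | _) _) => S; lia.
  + have vw i : v i = w i.
      apply/eqP; rewrite -subr_eq0 -sqrf_eq0; apply/eqP.
      by apply: (psumr_eq0P _ QE) => // j _; apply: sqr_ge0.
    have : D = E by apply: eq_bigr => i _; rewrite vw.
    by lia.
(* The equations give [D = - a - 2] and [A = 5 + 2 F <= 7], against [D^2 <= A B]. *)
- have F1 : F <= 1 by rewrite B3 C1 in cF; nia.
  have a34 : a = 3 \/ a = 4 by lia.
  by case: a34 => aE; rewrite aE B3 C1 in e1 e2 e3 cD; nia.
(* The equations give [A = 5 - 2 a + 2 F], negative if [a >= 4]. If [a = 3], then [F = 1], [A = 1]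
   and [E = -3], against [E^2 <= A C]. *)
- have F1 : F <= 1 by rewrite B1 C3 in cF; nia.
  rewrite B1 C3 in e1 e2 e3 cE.
  have [a3'|a4] : a = 3 \/ 4 <= a by lia.
    by rewrite a3' in e1 e2 e3; nia.
  by lia.
Qed.

(** * The order generated by a root of the simplest cubic *)

Definition simplest_cubic (R : nzRingType) (a : int) : {poly R} :=
  'X^3 - a%:~R *: 'X^2 - (a + 3)%:~R *: 'X - 1.

Lemma map_simplest_cubic (R S : nzRingType) (f : {rmorphism R -> S}) a :
  map_poly f (simplest_cubic R a) = simplest_cubic S a.
Proof.
by rewrite /simplest_cubic !rmorphB /= !map_polyZ /= !map_polyXn map_polyX rmorph1 !rmorph_int.
Qed.

Lemma simplest_cubicE (R : nzRingType) a :
  simplest_cubic R a = \poly_(i < 4) [:: -1; - (a + 3)%:~R; - a%:~R; 1]`_i.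
Proof.
apply/polyP => i; rewrite coef_poly /simplest_cubic !coefB !coefZ !coefXn coefX coef1.
by case: i => [|[|[|[|i]]]] //=; rewrite ?mulr0 ?mulr1 ?subr0 ?sub0r ?oppr0.
Qed.

Lemma size_simplest_cubic (R : nzRingType) a : size (simplest_cubic R a) = 4%N.
Proof. by rewrite simplest_cubicE size_poly_eq ?oner_neq0. Qed.

Lemma monic_simplest_cubic (R : nzRingType) a : simplest_cubic R a \is monic.
Proof. by rewrite monicE lead_coefE size_simplest_cubic simplest_cubicE coef_poly. Qed.

Lemma horner_simplest_cubic (R : nzRingType) a (x : R) :
  (simplest_cubic R a).[x] = x ^+ 3 - a%:~R * x ^+ 2 - (a%:~R + 3) * x - 1.
Proof.
by rewrite /simplest_cubic -polyC1 !(hornerD, hornerN, hornerZ, hornerXn, hornerX, hornerC) intrD.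
Qed.

(** An integral root would divide the constant term, hence be 1 or -1. *)
Lemma simplest_cubic_noroot a (m : int) : 3 <= a ->
  m ^+ 3 - a * m ^+ 2 - (a + 3) * m - 1 <> 0.
Proof.
move=> a3 E; have m1 : m * (m ^+ 2 - a * m - (a + 3)) = 1.
  by rewrite -[RHS]add0r -E; ring.
have : m \is a GRing.unit by apply/unitrP; exists (m ^+ 2 - a * m - (a + 3)); rewrite mulrC m1.
rewrite unitz_sqr sqrf_eq1 => /orP[] /eqP mE; rewrite mE in E; lia.
Qed.

(** A rational root would be an algebraic integer, hence an integer. *)
Lemma irreducible_simplest_cubic a : 3 <= a -> irreducible_poly (simplest_cubic rat a).
Proof.
move=> a3; apply: cubic_irreducible; first by rewrite size_simplest_cubic.
move=> x; apply/negP => rx.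
have : root (map_poly ratr (simplest_cubic rat a)) (ratr x : algC) by rewrite fmorph_root.
rewrite map_simplest_cubic => rx'.
have : (ratr x : algC) \in Aint.
  apply: root_monic_Aint rx' (monic_simplest_cubic _ _) _.
  apply/polyOverP => i; rewrite simplest_cubicE coef_poly.
  by case: i => [|[|[|[|i]]]] //=; rewrite ?rpredN ?rpred1 ?rpred0 ?intr_int.
move/(Cint_rat_Aint (Crat_rat x))/intrP => [m xm].
apply: (@simplest_cubic_noroot a m a3); apply: (@intr_inj algC).
move: rx'; rewrite xm rootE horner_simplest_cubic => /eqP E.
by rewrite [RHS]rmorph0 -[RHS]E; ring.
Qed.

(** * Arithmetic of the order in the basis [1, rho, conj_rho] *)

Section SimplestCubicRing.
Variables (a : int) (rho : algC).
Hypotheses (a3 : 3 <= a) (rho_root : root (simplest_cubic algC a) rho).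

Lemma rho_cube : rho ^+ 3 = a%:~R * rho ^+ 2 + (a%:~R + 3) * rho + 1.
Proof.
move: rho_root; rewrite rootE horner_simplest_cubic => /eqP E.
by apply/eqP; rewrite -subr_eq0 -[X in _ == X]E; apply/eqP; ring.
Qed.

Lemma rho_free (p : {poly rat}) : (size p < 4)%N -> root (map_poly ratr p) rho -> p = 0.
Proof.
move=> sp rp; apply/eqP; apply: contraLR sp => p0; rewrite -leqNgt.
have [_ irr] := irreducible_simplest_cubic a3.
have [cop|ncop] := boolP (coprimep (simplest_cubic rat a) p).
  have : coprimep (simplest_cubic algC a) (map_poly ratr p).
    by rewrite -(map_simplest_cubic (ratr : {rmorphism rat -> algC})) coprimep_map.
  by move/coprimep_root => /(_ _ rho_root); rewrite -rootE rp.
have := irr (gcdp (simplest_cubic rat a) p) ncop (dvdp_gcdl _ _).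
move=> /eqp_size; rewrite size_simplest_cubic => <-.
by apply: dvdp_leq p0 (dvdp_gcdr _ _).
Qed.

(* This is [- 1 / (1 + rho)], a conjugate of [rho]. *)
Definition conj_rho := rho ^+ 2 - (a%:~R + 1) * rho - 2.

Definition elt (u v w : int) : algC := u%:~R + v%:~R * rho + w%:~R * conj_rho.

Lemma elt_inj u v w u' v' w' : elt u v w = elt u' v' w' -> [/\ u = u', v = v' & w = w'].
Proof.
move=> E.
pose p : {poly rat} := \poly_(i < 3) [:: (u - u' - 2 * (w - w'))%:~R;
   ((v - v') - (a + 1) * (w - w'))%:~R; (w - w')%:~R]`_i.
have p0 : p = 0.
  apply: rho_free; first exact: leq_ltn_trans (size_poly _ _) _.
  have -> : map_poly ratr p = \poly_(i < 3) [:: (u - u' - 2 * (w - w'))%:~R;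
   ((v - v') - (a + 1) * (w - w'))%:~R; (w - w')%:~R]`_i :> {poly algC}.
    apply/polyP => i; rewrite coef_map !coef_poly.
    by case: i => [|[|[|i]]] /=; rewrite ?ratr_int ?rmorph0.
  rewrite rootE horner_poly !big_ord_recl big_ord0 /=.
  move/eqP: E; rewrite -subr_eq0 => /eqP E; apply/eqP; rewrite -[RHS]E /elt /conj_rho.
  rewrite /bump /= !rmorphB /= !rmorphM /= !rmorphB /= rmorphD /=; ring.
have c i : p`_i = 0 by rewrite p0 coef0.
have := c 0%N; have := c 1%N; have := c 2%N; rewrite !coef_poly /=.
move=> /eqP; rewrite intr_eq0 subr_eq0 => /eqP ->.
rewrite subrr !mulr0 !subr0 => /eqP; rewrite intr_eq0 subr_eq0 => /eqP ->.
by move=> /eqP; rewrite intr_eq0 subr_eq0 => /eqP ->.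
Qed.

Lemma elt_sqr u v w : elt u v w ^+ 2 =
  elt (u ^+ 2 + 2 * v ^+ 2 + (a + 2) * w ^+ 2 - 2 * (v * w))
      ((a + 1) * v ^+ 2 - w ^+ 2 + 2 * (u * v))
      (v ^+ 2 + a * w ^+ 2 + 2 * (u * w) - 2 * (v * w)).
Proof.
have e4 : rho ^+ 4 =
    (a%:~R ^+ 2 + a%:~R + 3) * rho ^+ 2 + (a%:~R ^+ 2 + 3 * a%:~R + 1) * rho + a%:~R.
  by rewrite exprS rho_cube !mulrDr mulrCA -exprS rho_cube; ring.
have e3 := rho_cube.
apply/eqP; rewrite -subr_eq0; apply/eqP.
transitivity (w%:~R ^+ 2 * (rho ^+ 4 - ((a%:~R ^+ 2 + a%:~R + 3) * rho ^+ 2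
    + (a%:~R ^+ 2 + 3 * a%:~R + 1) * rho + a%:~R))
  + (2 * v%:~R * w%:~R - 2 * (a%:~R + 1) * w%:~R ^+ 2) *
    (rho ^+ 3 - (a%:~R * rho ^+ 2 + (a%:~R + 3) * rho + 1)) : algC).
  by rewrite /elt /conj_rho; ring.
by rewrite e3 e4 !subrr !mulr0 addr0.
Qed.

Lemma elt_add u v w u' v' w' : elt u v w + elt u' v' w' = elt (u + u') (v + v') (w + w').
Proof. by rewrite /elt; ring. Qed.

Lemma elt_sum (I : finType) (u v w : I -> int) :
  \sum_i elt (u i) (v i) (w i) = elt (\sum_i u i) (\sum_i v i) (\sum_i w i).
Proof. by rewrite /elt !rmorph_sum /= !mulr_suml -!big_split. Qed.

Lemma elt_zadjoin u v w : elt u v w \in zadjoin rho.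
Proof.
have rX : rho \in zadjoin rho by apply/zadjoinP; exists 'X; rewrite map_polyX hornerX.
have rI (z : int) : z%:~R \in zadjoin rho.
  by apply/zadjoinP; exists z%:P; rewrite map_polyC hornerC.
have r2 : rho ^+ 2 - (a%:~R + 1) * rho - 2 \in zadjoin rho.
  have -> : rho ^+ 2 - (a%:~R + 1) * rho - 2 = rho ^+ 2 - (a + 1)%:~R * rho - 2%:~R by ring.
  by apply: rpredB => //; apply: rpredB; [exact: rpredX | exact: rpredM].
apply: rpredD; last by apply: rpredM => //.
by apply: rpredD => //; apply: rpredM => //.
Qed.

Lemma zadjoin_elt (x : Z[rho]) : exists u v w, val x = elt u v w.
Proof.
case: x => x /= /zadjoinP[p ->] {x}.
elim/poly_ind: p => [|p c [u [v [w pE]]]].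
  by exists 0, 0, 0; rewrite map_poly0 horner0 /elt; ring.
(* A Horner step, with [rho^2 = conj_rho + (a + 1) rho + 2] and
   [rho * conj_rho = - conj_rho - 1]. *)
exists (c + 2 * v - w), (u + (a + 1) * v), (v - w).
rewrite rmorphD rmorphM /= map_polyX map_polyC hornerD hornerMX hornerC /= pE.
apply/eqP; rewrite -subr_eq0; apply/eqP.
transitivity (w%:~R * (rho ^+ 3 - (a%:~R * rho ^+ 2 + (a%:~R + 3) * rho + 1)) : algC).
  by rewrite /elt /conj_rho; ring.
by rewrite rho_cube subrr mulr0.
Qed.

Definition zelt u v w : Z[rho] := ZAdjoin (elt_zadjoin u v w).

Lemma gram_ge0 n k (N : 'M[int]_(n, k)) y : 0 <= qform (N *m N^T) y.
Proof.
rewrite -{1}(mulmx1 N) qform_congr /qform mulmx1 mxE sumr_ge0 // => i _.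
by rewrite !mxE -expr2 sqr_ge0.
Qed.

Definition basis : 'rV[algC]_3 := vec3 1 rho conj_rho.

Lemma elt_basis (c : 'rV[int]_3) : elt (c 0 0) (c 0 1) (c 0 2) = (basis *m (map_mx intr c)^T) 0 0.
Proof.
rewrite mxE !big_ord_recl big_ord0 !mxE /= /elt.
have -> : lift ord0 (lift ord0 ord0) = 2 :> 'I_3 by apply: val_inj.
have -> : lift ord0 ord0 = 1 :> 'I_3 by apply: val_inj.
by ring.
Qed.

(** The sum depends on [N] only through its Gram matrix, so another factorization of that matrix
    gives the same element. *)
Lemma sum_elt_sqr n (N : 'M[int]_(3, n)) :
  \sum_i elt (N 0 i) (N 1 i) (N 2 i) ^+ 2 = qform (map_mx intr (N *m N^T)) basis.
Proof.
rewrite map_mxM -{1}(mulmx1 (map_mx intr N)) -map_trmx qform_congr /qform mulmx1 [RHS]mxE.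
apply: eq_bigr => i _; rewrite [(_^T) i 0]mxE -expr2; congr (_ ^+ 2).
have -> : N 0 i = (col i N)^T 0 0 by rewrite !mxE.
have -> : N 1 i = (col i N)^T 0 1 by rewrite !mxE.
have -> : N 2 i = (col i N)^T 0 2 by rewrite !mxE.
by rewrite elt_basis !mxE; apply: eq_bigr => j _; rewrite !mxE.
Qed.

Lemma sums_of_squares_zadjoin (x : Z[rho]) :
  sums_of_squares Z[rho] x -> sums_of_m_squares Z[rho] 6 x.
Proof.
move=> [n [al ->]].
have /boolp.choice[c cE] : forall i, exists c : 'rV[int]_3,
    val (al i) = elt (c 0 0) (c 0 1) (c 0 2).
  move=> i; have [u [v [w E]]] := zadjoin_elt (al i).
  by exists (vec3 u v w); rewrite !mxE.
pose N : 'M[int]_(3, n) := \matrix_(j, i) c i 0 j.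
have [||M ME] := @psd_ternary_six_squares (N *m N^T).
- by rewrite trmx_mul trmxK.
- exact: gram_ge0.
exists (fun j => zelt (M 0 j) (M 1 j) (M 2 j)); apply: val_inj.
rewrite !rmorph_sum.
transitivity (\sum_i elt (N 0 i) (N 1 i) (N 2 i) ^+ 2).
  by apply: eq_bigr => i _; rewrite rmorphXn [X in X ^+ 2]cE !mxE.
rewrite sum_elt_sqr ME -sum_elt_sqr.
by apply: eq_bigr => i _; rewrite rmorphXn.
Qed.

Lemma not_sum_of_five k : (k <= 5)%N -> sums_of_squares Z[rho] <> sums_of_m_squares Z[rho] k.
Proof.
move=> k5 E; pose x : Z[rho] := zelt (a + 13) (a - 2) (a - 1).
have [be xE] : sums_of_m_squares Z[rho] k x.
  rewrite -E; exists 6%N.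
  (* Four squares [1 + 1 + 1 + 4] for 7, then those of [rho - 1] and [conj_rho - 1]. *)
  exists (fun i : 'I_6 => nth 0 [:: zelt 1 0 0; zelt 1 0 0; zelt 1 0 0; zelt 2 0 0;
    zelt (-1) 1 0; zelt (-1) 0 1] i).
  apply: val_inj; rewrite rmorph_sum.
  under eq_bigr do rewrite rmorphXn.
  rewrite !big_ord_recl big_ord0 /= addr0 !elt_sqr !elt_add.
  by congr elt; ring.
have /boolp.choice[c cE] : forall i, exists c : int * int * int,
    val (be i) = elt c.1.1 c.1.2 c.2.
  by move=> i; have [u [v [w H]]] := zadjoin_elt (be i); exists (u, v, w).
have /(congr1 val) := xE; rewrite rmorph_sum.
under eq_bigr do rewrite rmorphXn [X in X ^+ 2]cE elt_sqr.
rewrite elt_sum => /elt_inj[/esym E1 /esym E2 /esym E3].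
exact: no_five_squares k5 a3 E1 E2 E3.
Qed.

End SimplestCubicRing.

Theorem theorem1p1 (a : int) (rho : algC) (a_ge3 : 3 <= a)
    (rho_root : root (map_poly intr
       ('X^3 - a *: 'X^2 - (a + 3) *: 'X - 1 : {poly int})) rho) :
  is_pythagoras_number (Z[rho] : comNzRingType) 6.
Proof.
have root' : root (simplest_cubic algC a) rho.
  move: rho_root; rewrite -(map_simplest_cubic (intr : {rmorphism int -> algC})).
  by rewrite /simplest_cubic !intz.
split=> [|k].
  apply/boolp.funext => x; apply/boolp.propext; split; last by exists 6%N.
  exact: sums_of_squares_zadjoin root' x.
by move=> E; rewrite leqNgt; apply/negP; rewrite ltnS => /(not_sum_of_five a_ge3 root'); apply.
Qed.
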